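(* For every positive integer $k$ there is an algorithm which, given any set $S$ of $n$ points in $\mathbb{R}^2$, computes a dominating set $S'\subseteq S$ of $S$ with $|S'|\le (1+\frac{1}{k})^2\,|OPT|$, where $OPT$ is a minimum dominating set of $S$, and which runs in $n^{O(k)}$ time.
   Context: For a finite point set $S\subset\mathbb{R}^2$, a dominating set of $S$ is a subset $S'\subseteq S$ such that every point of $S$ lies in at least one disk of radius $1$ centered at a point of $S'$, i.e. every point of $S$ is at Euclidean distance at most $1$ from some point of $S'$. A minimum dominating set is a dominating set of minimum cardinality. *)

(* Defs.v *)
From mathcomp Require Import all_boot all_order all_algebra finmap reals.

Set Implicit Arguments.
Unset Strict Implicit.
Unset Printing Implicit Defensive.

Import Order.TTheory GRing.Theory Num.Theory.
Local Open Scope ring_scope.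
Local Open Scope fset_scope.

(* The Euclidean distance is written out because the norm that the libraries
   attach to R * R is the sup norm. *)
Definition edist (R : realType) (p q : R * R) : R :=
  Num.sqrt ((p.1 - q.1) ^+ 2 + (p.2 - q.2) ^+ 2).

Definition dominating_set (R : realType) (S D : {fset R * R}) : Prop :=
  D `<=` S /\ forall p, p \in S -> exists2 q, q \in D & edist p q <= 1.

Definition minimum_dominating_set (R : realType) (S D : {fset R * R}) : Prop :=
  dominating_set S D /\
  forall D', dominating_set S D' -> (#|` D| <= #|` D'|)%N.

(* Algorithms are structured programs for a unit-cost real RAM.  There are
   integer registers and real registers, named statically, and an integer memory
   and a real memory, both addressed indirectly through integer registers.  The
   integer part has neither multiplication nor division, so that unit cost is
   polynomially equivalent to bit cost; the real part has the four field
   operations (division by 0 gives 0) and exact comparison.  There is no rounding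
   and no conversion from reals to integers, and the only literals are natural
   numbers, so that no information can be hidden in a real constant. *)
Inductive instr : Type :=
| IConst (x c : nat)
| IMove (x y : nat)
| IAdd (x y z : nat)
| ISub (x y z : nat)
| ILoad (x y : nat)
| IStore (x y : nat)
| RConst (x c : nat)
| RMove (x y : nat)
| RAdd (x y z : nat)
| RSub (x y z : nat)
| RMul (x y z : nat)
| RDiv (x y z : nat)
| RLoad (x y : nat)
| RStore (x y : nat).

Inductive test : Type :=
| ILe (x y : nat)
| RLe (x y : nat).

Inductive program : Type :=
| Skip
| Instr (i : instr)
| Seq (c1 c2 : program)
| If (b : test) (c1 c2 : program)
| While (b : test) (c : program).

Record state (R : realType) : Type := State {
  ireg : nat -> nat;
  rreg : nat -> R;
  imem : nat -> nat;
  rmem : nat -> R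
}.

Definition upd (T : Type) (f : nat -> T) (a : nat) (v : T) : nat -> T :=
  fun b => if b == a then v else f b.

Definition set_ireg (R : realType) (st : state R) (x v : nat) : state R :=
  State (upd (ireg st) x v) (rreg st) (imem st) (rmem st).

Definition set_rreg (R : realType) (st : state R) (x : nat) (v : R) : state R :=
  State (ireg st) (upd (rreg st) x v) (imem st) (rmem st).

Definition set_imem (R : realType) (st : state R) (a v : nat) : state R :=
  State (ireg st) (rreg st) (upd (imem st) a v) (rmem st).

Definition set_rmem (R : realType) (st : state R) (a : nat) (v : R) : state R :=
  State (ireg st) (rreg st) (imem st) (upd (rmem st) a v).

Definition step (R : realType) (i : instr) (st : state R) : state R :=
  match i with
  | IConst x c => set_ireg st x c
  | IMove x y => set_ireg st x (ireg st y)
  | IAdd x y z => set_ireg st x (ireg st y + ireg st z)%N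
  | ISub x y z => set_ireg st x (ireg st y - ireg st z)%N
  | ILoad x y => set_ireg st x (imem st (ireg st y))
  | IStore x y => set_imem st (ireg st x) (ireg st y)
  | RConst x c => set_rreg st x c%:R
  | RMove x y => set_rreg st x (rreg st y)
  | RAdd x y z => set_rreg st x (rreg st y + rreg st z)
  | RSub x y z => set_rreg st x (rreg st y - rreg st z)
  | RMul x y z => set_rreg st x (rreg st y * rreg st z)
  | RDiv x y z => set_rreg st x (rreg st y / rreg st z)
  | RLoad x y => set_rreg st x (rmem st (ireg st y))
  | RStore x y => set_rmem st (ireg st x) (rreg st y)
  end.

Definition holds (R : realType) (b : test) (st : state R) : bool :=
  match b with
  | ILe x y => (ireg st x <= ireg st y)%N
  | RLe x y => rreg st x <= rreg st y
  end.

(* In exec c st t st', t is the running time: every executed instruction and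
   every evaluated test costs 1. *)
Inductive exec (R : realType) : program -> state R -> nat -> state R -> Prop :=
| ExecSkip st : exec Skip st 1%N st
| ExecInstr i st : exec (Instr i) st 1%N (step i st)
| ExecSeq c1 c2 st t1 st1 t2 st2 :
    exec c1 st t1 st1 -> exec c2 st1 t2 st2 ->
    exec (Seq c1 c2) st (t1 + t2)%N st2
| ExecIfTrue b c1 c2 st t st' :
    holds b st = true -> exec c1 st t st' -> exec (If b c1 c2) st t.+1 st'
| ExecIfFalse b c1 c2 st t st' :
    holds b st = false -> exec c2 st t st' -> exec (If b c1 c2) st t.+1 st'
| ExecWhileFalse b c st :
    holds b st = false -> exec (While b c) st 1%N st
| ExecWhileTrue b c st t1 st1 t2 st2 :
    holds b st = true -> exec c st t1 st1 -> exec (While b c) st1 t2 st2 ->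
    exec (While b c) st (t1 + t2).+1 st2.

Lemma exec_det (R : realType) (c : program) (st : state R) t1 st1 t2 st2 :
  exec c st t1 st1 -> exec c st t2 st2 -> t1 = t2 /\ st1 = st2.
Proof.
move=> H; elim: H t2 st2 => {c st t1 st1}.
- by move=> st t2 st2 H; inversion H.
- by move=> i st t2 st2 H; inversion H.
- move=> c1 c2 st t1 st1 t2 st2 _ IH1 _ IH2 t st' H; inversion H; subst.
  match goal with h : exec c1 _ _ _ |- _ => case: (IH1 _ _ h) => ? ?; subst end.
  by match goal with h : exec c2 _ _ _ |- _ => case: (IH2 _ _ h) => ? ?; subst end.
- move=> b c1 c2 st t st' hb _ IH t2 st2 H; inversion H; subst; last congruence.
  by match goal with h : exec c1 _ _ _ |- _ => case: (IH _ _ h) => ? ?; subst end.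
- move=> b c1 c2 st t st' hb _ IH t2 st2 H; inversion H; subst; first congruence.
  by match goal with h : exec c2 _ _ _ |- _ => case: (IH _ _ h) => ? ?; subst end.
- by move=> b c st hb t2 st2 H; inversion H; subst => //; congruence.
- move=> b c st t1 st1 t2 st2 hb _ IH1 _ IH2 t st' H; inversion H; subst.
    congruence.
  match goal with h : exec c _ _ _ |- _ => case: (IH1 _ _ h) => ? ?; subst end.
  by match goal with h : exec (While b c) _ _ _ |- _ =>
    case: (IH2 _ _ h) => ? ?; subst end.
Qed.

(* The input points are listed in s: register i_0 holds their number n, and
   rmem[2 i], rmem[2 i + 1] hold the coordinates of the i-th point for i < n.
   Everything else is 0. *)
Definition input_state (R : realType) (s : seq (R * R)) : state R :=
  State (fun x => if x == 0%N then size s else 0%N)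
        (fun=> 0)
        (fun=> 0%N)
        (fun a => let p := nth (0, 0) s a./2 in if odd a then p.2 else p.1).

(* The i-th input point is selected iff imem[i] is nonzero at halting time. *)
Definition output_set (R : realType) (s : seq (R * R)) (st : state R) :
    {fset R * R} :=
  [fset p in s | imem st (index p s) != 0%N].

(* Main.v *)
(* Shifting in one direction suffices.  Points are grouped into rows of height
   less than 2 such that a unit disk meets at most two consecutive rows.  For a
   shift r < k, k consecutive rows form a strip; summing over r, a disk meets at
   most k + 1 strips in total, so for the best r the optima of the strips add up
   to at most (1 + 1/k) |OPT|.

   Order the points by strip, then by abscissa.  The points of OPT that dominate,
   within the current strip, both some earlier and some later point form a window
   of O(k) points (by packing, since OPT is minimum) which dominates the current
   point, and each point of OPT enters the window once per strip that its disk
   meets.  Conversely, every sequence of sets whose t-th member dominates the t-th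
   point has a dominating union.  A shortest path over the pairs (set of O(k)
   points, shift), where moving from a set to the next costs the number of new
   points, is thus the desired dominating set, and there are n^O(k) such pairs.

   The algorithm is written in a language of expressions with bounded sums, whose
   compilation to the real RAM is proved correct with a static time bound. *)
Require Import Defs.
From mathcomp Require Import all_boot all_order all_algebra finmap boolp reals.
From mathcomp Require Import zify lra.

Set Implicit Arguments.
Unset Strict Implicit.
Unset Printing Implicit Defensive.

Import Order.TTheory GRing.Theory Num.Theory.

(** * Expressions with bounded sums and their compilation *)

(** The machine cannot round reals, so rows cannot come from a fixed grid. The row of a point is
    instead the length of a longest chain descending from it with vertical gaps at least 2, which
    comparisons alone determine.

    A minimum dominating set may have clustered points, so packing is not applied to a window itself
    but to separated points that it dominates, which by minimality can be chosen at least as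
    numerous. Cells of side 1/2, with 16 residues per direction, then give the bound
    [16 * 16 * k = 256 * k], the exponent of the number of coded sets.

    Since the shift is part of the node and changing it is penalised, one path computation tries all
    shifts. The best path costs at most [(1 + 1/k) * |OPT| <= 2 * n], whereas a missed point or a
    change of shift costs [2 * n + 1]; a shortest path therefore has neither defect, and its union
    is feasible.

    For an exponent linear in [k], the nesting depth of loops must not depend on [k]: here [k]
    enters only as a literal and as a number of repeated statements. Every statement then takes a
    fixed power of the parameters, which are [n^O(k)]. *)

Inductive geo := Near | XLe | YGap.

Inductive expr :=
| Cst (c : nat)
| Var (x : nat)
| Add (e1 e2 : expr)
| Sub (e1 e2 : expr)
| Get (e : expr)
| Ite (e e1 e2 : expr)
| Bind (x : nat) (e1 e2 : expr)
| Sum (x y : nat) (e : expr)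
| Geo (g : geo) (x y : nat).

Fixpoint eval (G : geo -> rel nat) (env mem : nat -> nat) (e : expr) : nat :=
  match e with
  | Cst c => c
  | Var x => env x
  | Add e1 e2 => eval G env mem e1 + eval G env mem e2
  | Sub e1 e2 => eval G env mem e1 - eval G env mem e2
  | Get e => mem (eval G env mem e)
  | Ite e e1 e2 =>
      if eval G env mem e != 0 then eval G env mem e1 else eval G env mem e2
  | Bind x e1 e2 => eval G (upd env x (eval G env mem e1)) mem e2
  | Sum x y e => \sum_(i < env y) eval G (upd env x i) mem e
  | Geo g x y => G g (env x) (env y)
  end.

(* The variables below [nparam] are global parameters, which expressions never
   rebind and which alone bound the sums: the running time is then controlled
   by a bound on the parameters. *)
Definition nparam := 10.

Fixpoint wf (e : expr) : bool :=
  match e with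
  | Cst _ | Var _ | Geo _ _ _ => true
  | Add e1 e2 | Sub e1 e2 => wf e1 && wf e2
  | Get e => wf e
  | Ite e e1 e2 => [&& wf e, wf e1 & wf e2]
  | Bind x e1 e2 => [&& nparam <= x, wf e1 & wf e2]
  | Sum x y e => [&& nparam <= x, y < nparam & wf e]
  end.

Fixpoint cost (B : nat) (e : expr) : nat :=
  match e with
  | Cst _ | Var _ => 2
  | Add e1 e2 | Sub e1 e2 => cost B e1 + cost B e2 + 2
  | Get e => cost B e + 2
  | Ite e e1 e2 => cost B e + cost B e1 + cost B e2 + 3
  | Bind x e1 e2 => cost B e1 + cost B e2 + 6
  | Sum x y e => B * (cost B e + 5) + 9
  | Geo _ _ _ => 20
  end.

Fixpoint height (e : expr) : nat :=
  match e with
  | Cst _ | Var _ => 1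
  | Add e1 e2 | Sub e1 e2 => height e1 + height e2 + 1
  | Get e => height e + 1
  | Ite e e1 e2 => height e + height e1 + height e2 + 1
  | Bind x e1 e2 => height e1 + height e2 + 1
  | Sum x y e => height e + 2
  | Geo _ _ _ => 1
  end.

(** Only [B] grows with the input, so the time is polynomial in [B] with a degree fixed by the text
    of [e]. The offset 20 makes every factor large enough for products to absorb sums and added
    constants. *)
Lemma cost_height B e : cost B e <= (B + 20) ^ height e.
Proof.
have h1 a : 0 < (B + 20) ^ a by rewrite expn_gt0; lia.
have h1' a : 0 < a -> 20 <= (B + 20) ^ a.
  case: a => // a _; rewrite expnS; move: (h1 a) => ?; nia.
have pos : forall e, 0 < height e by elim=> *; rewrite /=; lia.
elim: e => /= [c|x|e1 I1 e2 I2|e1 I1 e2 I2|e I|e I e1 I1 e2 I2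
  |x e1 I1 e2 I2|x y e I|g x y].
- by rewrite expn1; lia.
- by rewrite expn1; lia.
- rewrite !expnD expn1; have := h1' _ (pos e1); have := h1' _ (pos e2); nia.
- rewrite !expnD expn1; have := h1' _ (pos e1); have := h1' _ (pos e2); nia.
- rewrite !expnD expn1; have := h1' _ (pos e); nia.
- rewrite !expnD expn1; have := h1' _ (pos e1); have := h1' _ (pos e2).
  have := h1' _ (pos e); set a := _ ^ _ in I *; set b := _ ^ height e1 in I1 *.
  set c := _ ^ height e2 in I2 * => p1 p2 p3.
  have : a + b + c <= a * b * c.
    apply: (@leq_trans (a * b + c)); first by nia.
    nia.
  nia.
- rewrite !expnD expn1; have := h1' _ (pos e1); have := h1' _ (pos e2); nia.
- rewrite !expnD; have := h1' _ (pos e); rewrite -mulnn; nia.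
- by rewrite expn1 leq_addl.
Qed.

(** Even registers hold variables and odd ones temporaries. As [vreg 0] is register 0, variable 0 is
    the number of points from the start. *)
Definition vreg x := x.*2.
Definition treg d := d.*2.+1.

Lemma vvE x y : (vreg x == vreg y) = (x == y). Proof. rewrite /vreg; lia. Qed.
Lemma vtE x y : (vreg x == treg y) = false. Proof. rewrite /vreg /treg; lia. Qed.
Lemma tvE x y : (treg x == vreg y) = false. Proof. rewrite /vreg /treg; lia. Qed.
Lemma ttE x y : (treg x == treg y) = (x == y). Proof. rewrite /treg; lia. Qed.

Fixpoint block (l : seq instr) : program :=
  if l is i :: l' then Seq (Instr i) (block l') else Skip.

Arguments block : simpl never.

Definition cgeo (g : geo) : seq instr * test :=
  match g with
  | Near => ([:: RSub 0 0 2; RMul 0 0 0; RSub 1 1 3; RMul 1 1 1; RAdd 0 0 1;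
                 RConst 2 1], RLe 0 2)
  | XLe => ([::], RLe 0 2)
  | YGap => ([:: RConst 0 2; RAdd 1 1 0], RLe 1 3)
  end.

(* Variable [x] lives in [vreg x]; the code uses only the temporaries [treg j]
   with [d <= j], leaves its result in [treg d] and restores all variables. *)
Fixpoint cexpr (d : nat) (e : expr) : program :=
  match e with
  | Cst c => block [:: IConst (treg d) c]
  | Var x => block [:: IMove (treg d) (vreg x)]
  | Add e1 e2 =>
      Seq (cexpr d e1) (Seq (cexpr d.+1 e2)
        (block [:: IAdd (treg d) (treg d) (treg d.+1)]))
  | Sub e1 e2 =>
      Seq (cexpr d e1) (Seq (cexpr d.+1 e2)
        (block [:: ISub (treg d) (treg d) (treg d.+1)]))
  | Get e => Seq (cexpr d e) (block [:: ILoad (treg d) (treg d)])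
  | Ite e e1 e2 =>
      Seq (cexpr d e) (Seq (block [:: IConst (treg d.+1) 0])
        (If (ILe (treg d) (treg d.+1)) (cexpr d e2) (cexpr d e1)))
  | Bind x e1 e2 =>
      Seq (cexpr d e1)
        (Seq (block [:: IMove (treg d.+1) (vreg x); IMove (vreg x) (treg d)])
          (Seq (cexpr d.+2 e2)
            (block [:: IMove (vreg x) (treg d.+1);
                       IMove (treg d) (treg d.+2)])))
  | Sum x y e =>
      Seq (block [:: IConst (treg d) 0; IMove (treg d.+1) (vreg x);
                     IConst (vreg x) 0; IConst (treg d.+2) 1;
                     IConst (treg d.+3) 1])
        (Seq (While (ILe (treg d.+2) (vreg y))
               (Seq (cexpr d.+4 e)
                 (block [:: IAdd (treg d) (treg d) (treg d.+4);
                            IMove (vreg x) (treg d.+2);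
                            IAdd (treg d.+2) (treg d.+2) (treg d.+3)])))
          (block [:: IMove (vreg x) (treg d.+1)]))
  | Geo g x y =>
      Seq (block ([:: IAdd (treg d) (vreg x) (vreg x); RLoad 0 (treg d);
                      IConst (treg d.+1) 1;
                      IAdd (treg d) (treg d) (treg d.+1); RLoad 1 (treg d);
                      IAdd (treg d) (vreg y) (vreg y); RLoad 2 (treg d);
                      IAdd (treg d) (treg d) (treg d.+1); RLoad 3 (treg d)]
                  ++ (cgeo g).1))
        (If (cgeo g).2 (block [:: IConst (treg d) 1])
                       (block [:: IConst (treg d) 0]))
  end.

(** * Timed execution rules and correctness of compiled expressions *)

Section Runs.
Variable R : realType.
Implicit Types (st : state R) (Q : state R -> Prop).

(** A timed Hoare judgement for total correctness. The time is only bounded, so that [T] can be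
    static although the actual time depends on the data. *)
Definition runs c st T Q := exists t st', [/\ exec c st t st', t <= T & Q st'].

Lemma runs_block l st T Q :
  size l < T -> Q (foldl (fun st i => step i st) st l) -> runs (block l) st T Q.
Proof.
move=> sT HQ; exists (size l).+1, (foldl (fun st i => step i st) st l).
split=> // {Q HQ sT}; elim: l st => [|i l IH] st /=; first exact: ExecSkip.
by rewrite -add1n; apply: ExecSeq (IH _); apply: ExecInstr.
Qed.

Lemma runs_seq c1 c2 st T1 T2 T Q1 Q :
  T1 + T2 <= T -> runs c1 st T1 Q1 ->
  (forall st', Q1 st' -> runs c2 st' T2 Q) -> runs (Seq c1 c2) st T Q.
Proof.
move=> lT [t1 [st1 [e1 l1 q1]]] /(_ _ q1) [t2 [st2 [e2 l2 q2]]].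
exists (t1 + t2), st2; split=> //; first exact: ExecSeq e2.
by apply: leq_trans lT; apply: leq_add.
Qed.

Lemma runs_if b c1 c2 st T Q :
  (if holds b st then runs c1 st T Q else runs c2 st T Q) ->
  runs (If b c1 c2) st T.+1 Q.
Proof.
case E: (holds b st) => -[t [st' [e l q]]]; exists t.+1, st'; split=> //.
  exact: ExecIfTrue.
exact: ExecIfFalse.
Qed.

Lemma runs_weaken c st T T' Q Q' :
  T <= T' -> (forall st', Q st' -> Q' st') -> runs c st T Q -> runs c st T' Q'.
Proof.
move=> lT HQ [t [st' [e l q]]]; exists t, st'; split; [by []| |exact: HQ].
exact: leq_trans lT.
Qed.

Lemma runs_while (Inv : nat -> state R -> Prop) b c st N T :
  (forall i st', i <= N -> Inv i st' -> holds b st' = (i < N)) ->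
  (forall i st', i < N -> Inv i st' -> runs c st' T (Inv i.+1)) ->
  Inv 0 st -> runs (While b c) st (N * T.+1 + 1) (Inv N).
Proof.
move=> Hb Hc; suff H j i st' : i + j = N -> Inv i st' ->
    runs (While b c) st' (j * T.+1 + 1) (Inv N) by apply: (H N 0).
elim: j i st' => [|j IH] i st' E I.
  exists 1, st'; split=> //; last by rewrite -E addn0.
  by apply: ExecWhileFalse; rewrite (Hb i) //; lia.
have lt_i : i < N by lia.
have [t1 [st1 [e1 l1 q1]]] := Hc _ _ lt_i I.
have [|t2 [st2 [e2 l2 q2]]] := IH i.+1 st1 _ q1; first by lia.
exists (t1 + t2).+1, st2; split=> //; last by lia.
by apply: ExecWhileTrue e1 e2; rewrite (Hb i) // ltnW.
Qed.

Variable s : seq (R * R).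

(** The machine takes no square roots, so the squared distance is compared. The default point is
    that of [input_state], which makes compiled tests agree with [pt_rel] at all indices, also out
    of range. *)
Definition pt_rel (g : geo) (i j : nat) : bool :=
  let p := nth (0, 0)%R s i in let q := nth (0, 0)%R s j in
  match g with
  | Near => ((p.1 - q.1) ^+ 2 + (p.2 - q.2) ^+ 2 <= 1)%R
  | XLe => (p.1 <= q.1)%R
  | YGap => (p.2 + 2 <= q.2)%R
  end.

Definition env_of st : nat -> nat := fun x => ireg st (vreg x).

(** Real registers are left out because each geometric test loads everything that it reads. *)
Record keeps (d : nat) st st' : Prop := Keeps {
  keeps_env : env_of st' = env_of st;
  keeps_tmp : forall j, j < d -> ireg st' (treg j) = ireg st (treg j);
  keeps_imem : imem st' = imem st;
  keeps_rmem : rmem st' = rmem st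
}.

Definition params_le (B : nat) (env : nat -> nat) :=
  forall y, y < nparam -> env y <= B.

Lemma params_le_upd B env x v :
  nparam <= x -> params_le B env -> params_le B (upd env x v).
Proof. by move=> hx H y hy; rewrite /upd; case: eqP => [E|_]; [lia|exact: H]. Qed.


Lemma env_of_treg st d v : env_of (set_ireg st (treg d) v) = env_of st.
Proof. by apply: funext => x; rewrite /env_of /= /upd vtE. Qed.

Lemma env_of_vreg st x v :
  env_of (set_ireg st (vreg x) v) = upd (env_of st) x v.
Proof. by apply: funext => y; rewrite /env_of /= /upd vvE. Qed.

Lemma upd_id (T : Type) (f : nat -> T) x v w :
  upd (upd f x v) x w = upd f x w.
Proof. by apply: funext => y; rewrite /upd; case: eqP. Qed.

Lemma upd_same (T : Type) (f : nat -> T) x : upd f x (f x) = f.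
Proof. by apply: funext => y; rewrite /upd; case: eqP => [->|]. Qed.

Lemma keeps_trans d d' st1 st2 st3 :
  d <= d' -> keeps d st1 st2 -> keeps d' st2 st3 -> keeps d st1 st3.
Proof.
move=> dd [a1 b1 c1 e1] [a2 b2 c2 e2]; split; rewrite ?a2 ?c2 ?e2 // => j jd.
by rewrite b2 ?b1 //; lia.
Qed.

Lemma keeps_set d d' st v : d <= d' -> keeps d st (set_ireg st (treg d') v).
Proof.
move=> dd; split; rewrite ?env_of_treg // => j jd /=.
by rewrite /upd ttE; case: eqP => // ?; lia.
Qed.

Lemma vreg_set st y v d : ireg (set_ireg st (vreg y) v) (treg d) = ireg st (treg d).
Proof. by rewrite /= /upd tvE. Qed.

Lemma env_ofE st x : ireg st (vreg x) = env_of st x. Proof. by []. Qed.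

Ltac numcase := repeat match goal with
  |- context [?a == ?b :> nat] => case: (@eqP _ a b) => // ?; try lia end.
Ltac regs := rewrite /= /upd /= ?(vvE, vtE, tvE, ttE, eqxx) /=; numcase.

Lemma cexprP B e d st :
  wf e -> params_le B (env_of st) -> rmem st = rmem (input_state s) ->
  runs (cexpr d e) st (cost B e) (fun st' => keeps d st st' /\
    ireg st' (treg d) = eval pt_rel (env_of st) (imem st) e).
Proof.
(* Addition and subtraction share one argument: the first result, in [treg d], survives the second
   computation, which runs at depth [d.+1]. *)
have bop e1 e2 (op : nat -> nat -> nat) i :
    (forall d st, wf e1 -> params_le B (env_of st) ->
      rmem st = rmem (input_state s) ->
      runs (cexpr d e1) st (cost B e1) (fun st' => keeps d st st' /\
      ireg st' (treg d) = eval pt_rel (env_of st) (imem st) e1)) ->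
    (forall d st, wf e2 -> params_le B (env_of st) ->
      rmem st = rmem (input_state s) ->
      runs (cexpr d e2) st (cost B e2) (fun st' => keeps d st st' /\
      ireg st' (treg d) = eval pt_rel (env_of st) (imem st) e2)) ->
    (forall d st, step (i d) st = set_ireg st (treg d)
       (op (ireg st (treg d)) (ireg st (treg d.+1)))) ->
    forall d st, wf e1 && wf e2 -> params_le B (env_of st) ->
      rmem st = rmem (input_state s) ->
    runs (Seq (cexpr d e1) (Seq (cexpr d.+1 e2) (block [:: i d]))) st
      (cost B e1 + cost B e2 + 2) (fun st' => keeps d st st' /\
      ireg st' (treg d) = op (eval pt_rel (env_of st) (imem st) e1)
                             (eval pt_rel (env_of st) (imem st) e2)).
  move=> I1 I2 iE {d st} d st' /andP[w1 w2] hB hr.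
  apply: (runs_seq (T2 := cost B e2 + 2) _ (I1 d st' w1 hB hr)); first by lia.
  move=> st1 [k1 v1].
  apply: (runs_seq (T2 := 2) _ (I2 d.+1 st1 w2 _ _)).
  - by [].
  - by rewrite (keeps_env k1).
  - by rewrite (keeps_rmem k1).
  move=> st2 [k2 v2]; apply: runs_block => //=; rewrite iE; split.
    exact: keeps_trans (leqnn d) (keeps_trans (leqnSn d) k1 k2) (keeps_set _ _ _).
  rewrite /= /upd eqxx v2 (keeps_tmp k2) // v1.
  by rewrite (keeps_env k1) (keeps_imem k1).
elim: e d st => /=
  [c|x|e1 I1 e2 I2|e1 I1 e2 I2|e I|e I e1 I1 e2 I2|x e1 I1 e2 I2|x y e I|g x y] d st.
- move=> _ _ _; apply: runs_block => //=; split; first exact: keeps_set.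
  by regs.
- move=> _ _ _; apply: runs_block => //=; split; first exact: keeps_set.
  by regs.
- exact: (bop _ _ addn (fun d => IAdd (treg d) (treg d) (treg d.+1))).
- exact: (bop _ _ subn (fun d => ISub (treg d) (treg d) (treg d.+1))).
- move=> w hB hr; apply: (runs_seq (T2 := 2) _ (I d st w hB hr)) => //.
  move=> st1 [k1 v1]; apply: runs_block => //=; split.
    by apply: keeps_trans (leqnn d) k1 (keeps_set _ _ _).
  by rewrite /upd eqxx v1 (keeps_imem k1).
- move=> /and3P[w w1 w2] hB hr.
  apply: (runs_seq (T2 := cost B e1 + cost B e2 + 3) _ (I d st w hB hr)).
    by lia.
  move=> st1 [k1 v1].
  set st2 := set_ireg st1 (treg d.+1) 0.
  apply: (runs_seq (T1 := 2) (T2 := (cost B e1 + cost B e2).+1)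
     (Q1 := fun st => st = st2)); [by lia|exact: runs_block|].
  move=> _ ->; apply: runs_if.
  have k2 : keeps d st st2 by apply: keeps_trans (leqnn d) k1 (keeps_set _ _ _).
  have -> : holds (ILe (treg d) (treg d.+1)) st2 =
            (eval pt_rel (env_of st) (imem st) e == 0).
    by rewrite -v1 /st2; regs; rewrite leqn0.
  have hB2 : params_le B (env_of st2) by rewrite (keeps_env k2).
  have hr2 : rmem st2 = rmem (input_state s) by rewrite (keeps_rmem k2).
  case: eqP => _ /=.
    apply: runs_weaken (I2 d st2 w2 hB2 hr2); first by lia.
    move=> st' [kk ->]; rewrite (keeps_env k2) (keeps_imem k2); split=> //.
    exact: keeps_trans (leqnn d) k2 kk.
  apply: runs_weaken (I1 d st2 w1 hB2 hr2); first by lia.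
  move=> st' [kk ->]; rewrite (keeps_env k2) (keeps_imem k2); split=> //.
  exact: keeps_trans (leqnn d) k2 kk.
- move=> /and3P[px w1 w2] hB hr.
  apply: (runs_seq (T2 := cost B e2 + 6) _ (I1 d st w1 hB hr)); first by lia.
  move=> st1 [k1 v1].
  set st2 := set_ireg (set_ireg st1 (treg d.+1) (env_of st1 x)) (vreg x)
               (ireg st1 (treg d)).
  apply: (runs_seq (T1 := 3) (T2 := cost B e2 + 3)
     (Q1 := fun st => st = st2)); first by lia.
    apply: runs_block => //=; rewrite /st2; congr (set_ireg _ _ _).
    by regs.
  move=> _ ->.
  have E2 : env_of st2 = upd (env_of st) x (eval pt_rel (env_of st) (imem st) e1).
    by rewrite env_of_vreg env_of_treg v1 (keeps_env k1).
  apply: (runs_seq (T2 := 3) _ (I2 d.+2 st2 w2 _ _)) => //.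
  + by rewrite E2; apply: params_le_upd.
  + by rewrite /= (keeps_rmem k1).
  move=> st3 [k3 v3]; apply: runs_block => //=; split; last first.
    by regs; rewrite v3 E2 /st2 /= (keeps_imem k1).
  split; rewrite ?env_of_treg ?env_of_vreg.
  + rewrite (keeps_env k3) E2 upd_id (keeps_tmp k3) //.
    rewrite [ireg st2 _](_ : _ = env_of st x) ?upd_same //.
    by rewrite /st2 vreg_set /= /upd eqxx (keeps_env k1).
  + move=> j jd; regs; rewrite (keeps_tmp k3); last by lia.
    by rewrite /st2; regs; exact: (keeps_tmp k1).
  + by rewrite /= (keeps_imem k3) /st2 /= (keeps_imem k1).
  + by rewrite /= (keeps_rmem k3) /st2 /= (keeps_rmem k1).
- move=> /and3P[px py w] hB hr.
  set N := env_of st y; pose f i := eval pt_rel (upd (env_of st) x i) (imem st) e.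
  (* The counter [treg d.+2] is one ahead of [x]: the machine only tests [<=], and [i.+1 <= N]
     expresses [i < N]. *)
  pose Inv i st' := [/\ env_of st' = upd (env_of st) x i,
    [/\ ireg st' (treg d) = \sum_(j < i) f j,
    ireg st' (treg d.+1) = env_of st x, ireg st' (treg d.+2) = i.+1 &
    ireg st' (treg d.+3) = 1],
    forall j, j < d -> ireg st' (treg j) = ireg st (treg j),
    imem st' = imem st & rmem st' = rmem st].
  have NB : N <= B by apply: hB.
  apply: (runs_seq (T1 := 6) (T2 := N * (cost B e + 5) + 3) (Q1 := Inv 0)).
  + have := leq_mul NB (leqnn (cost B e + 5)); lia.
  + apply: runs_block => //=; split; rewrite ?(env_of_treg, env_of_vreg) //.
    * by split; regs; rewrite ?big_ord0 //.
    * by move=> j jd; regs.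
  move=> st1 I0.
  apply: (runs_seq (T1 := N * (cost B e + 4).+1 + 1) (T2 := 2) (Q1 := Inv N)).
  + by rewrite !addnS; lia.
  + apply: runs_while I0.
    * move=> i st' iN [E [_ _ c2 _] _ _ _] /=; rewrite c2 env_ofE E /upd.
      by case: eqP => // E'; exfalso; move: px py E'; rewrite /nparam; lia.
    move=> i st' iN [E [c0 c1 c2 c3] Et Ei Er].
    apply: (runs_seq (T2 := 4) _ (I d.+4 st' w _ _)) => //.
    * by rewrite E; apply: params_le_upd.
    * by rewrite Er.
    move=> st2 [k2 v2]; apply: runs_block => //=; split.
    * rewrite !env_of_treg env_of_vreg env_of_treg (keeps_env k2) E upd_id.
      by congr (upd _ _ _); regs; rewrite (keeps_tmp k2) // ltnS leqW //.
    * split; regs; rewrite ?v2 ?(keeps_tmp k2) ?c0 ?c1 ?c2 ?c3; try lia.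
      by rewrite big_ord_recr E Ei.
    * by move=> j jd; regs; rewrite (keeps_tmp k2) ?Et //; lia.
    * by rewrite /= (keeps_imem k2).
    * by rewrite /= (keeps_rmem k2).
  move=> st2 [E [c0 c1 c2 c3] Et Ei Er]; apply: runs_block => //=; split; last first.
    by regs.
  split=> //=; last by move=> j jd; regs; apply: Et.
  by rewrite env_of_vreg E upd_id c1 upd_same.
- move=> _ hB hr.
  apply: (runs_seq (T1 := 16) (T2 := 3) (Q1 := fun st' => keeps d st st' /\
    holds (cgeo g).2 st' = pt_rel g (env_of st x) (env_of st y))) => //.
  + apply: runs_block; first by case: (g).
    rewrite /=; set st1 := (X in foldl _ X _).
    have k1 : keeps d st st1.
      split=> //; first by apply: funext => z; rewrite /env_of /st1; regs.
      by move=> j jd; rewrite /st1; regs.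
    have [r0 r1 r2 r3] : let p := nth (0, 0)%R s (env_of st x) in
        let q := nth (0, 0)%R s (env_of st y) in
        [/\ rreg st1 0 = p.1, rreg st1 1 = p.2, rreg st1 2 = q.1 &
            rreg st1 3 = q.2].
      rewrite /st1; regs; rewrite hr /= !addn1 !addnn /=.
      by rewrite !odd_double !uphalf_double !doubleK.
    move: st1 k1 r0 r1 r2 r3 => st1 k1 r0 r1 r2 r3; split.
      by case: (k1) => kE kt ki kr; split; case: (g).
    by case: (g); rewrite /= /upd /= ?(r0, r1, r2, r3).
  move=> st1 [k1 h1]; apply: runs_if; rewrite h1.
  by case: (pt_rel g _ _); apply: runs_block => //=; (split;
    [exact: keeps_trans (leqnn d) k1 (keeps_set _ _ _)|by rewrite /= /upd eqxx]).
Qed.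
End Runs.

(** * Statements that set parameters and fill tables *)

Inductive stmt :=
| Assign (y : nat) (e : expr)
| Tab (x y : nat) (ea ev : expr).

(** Each entry is evaluated in the memory left by the previous ones, which allows recursion on the
    index of the table. *)
Definition tab_step G env x ea ev (mem : nat -> nat) (i : nat) : nat -> nat :=
  upd mem (eval G (upd env x i) mem ea) (eval G (upd env x i) mem ev).

Definition sem G (c : stmt) (em : (nat -> nat) * (nat -> nat)) :=
  let: (env, mem) := em in
  match c with
  | Assign y e => (upd env y (eval G env mem e), mem)
  | Tab x y ea ev => (upd env x (env y),
      foldl (tab_step G env x ea ev) mem (iota 0 (env y)))
  end.

Definition cstmt (c : stmt) : program :=
  match c with
  | Assign y e => Seq (cexpr 0 e) (block [:: IMove (vreg y) (treg 0)])
  | Tab x y ea ev =>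
      Seq (block [:: IConst (vreg x) 0; IConst (treg 0) 1; IConst (treg 1) 1])
        (While (ILe (treg 0) (vreg y))
          (Seq (cexpr 2 ea) (Seq (cexpr 3 ev)
            (block [:: IStore (treg 2) (treg 3); IMove (vreg x) (treg 0);
                       IAdd (treg 0) (treg 0) (treg 1)]))))
  end.

Definition wf_stmt (c : stmt) : bool :=
  match c with
  | Assign y e => wf e
  | Tab x y ea ev => [&& nparam <= x, y < nparam, wf ea & wf ev]
  end.

Definition stmt_cost B (c : stmt) : nat :=
  match c with
  | Assign y e => cost B e + 2
  | Tab x y ea ev => B * (cost B ea + cost B ev + 5) + 5
  end.

Definition stmt_height (c : stmt) : nat :=
  match c with
  | Assign y e => height e + 1
  | Tab x y ea ev => height ea + height ev + 3
  end.

Lemma stmt_cost_height B c : stmt_cost B c <= (B + 20) ^ stmt_height c.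
Proof.
have pos e : 0 < height e by elim: e => *; rewrite /=; lia.
have h e : 20 <= (B + 20) ^ height e.
  by rewrite -[X in X <= _]expn1; apply: leq_trans (leq_pexp2l _ (pos e));
     rewrite ?leq_exp2r ?leq_addl ?addnS.
case: c => [y e|x y e1 e2] /=.
  by rewrite expnD expn1; have := cost_height B e; have := h e; nia.
rewrite !expnD !expnS expn0 muln1.
have := cost_height B e1; have := cost_height B e2; have := h e1; have := h e2.
move: (_ ^ _) (_ ^ _) => a b; move: (cost _ _) (cost _ _) => c d *.
have : c + d + 5 <= a * b * (B + 20) by nia.
have : 5 <= a * b by nia.
nia.
Qed.

Definition sems G (l : seq stmt) em := foldl (fun em c => sem G c em) em l.

Lemma sems_cat G l1 l2 em : sems G (l1 ++ l2) em = sems G l2 (sems G l1 em).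
Proof. exact: foldl_cat. Qed.

(** Statements change the parameters that bound the loops, so the bound [B] has to be checked at
    every statement of the run. *)
Fixpoint safe G B (l : seq stmt) em : Prop :=
  if l is c :: l' then params_le B em.1 /\ safe G B l' (sem G c em) else True.

Lemma safe_cat G B l1 l2 em :
  safe G B l1 em -> safe G B l2 (sems G l1 em) -> safe G B (l1 ++ l2) em.
Proof. by elim: l1 em => //= c l1 IH em [h1 h2] h3; split=> //; apply: IH. Qed.

Section RunStmt.
Variables (R : realType) (s : seq (R * R)).
Local Notation G := (pt_rel s).

Lemma cstmtP B c (st : state R) :
  wf_stmt c -> params_le B (env_of st) -> rmem st = rmem (input_state s) ->
  runs (cstmt c) st (stmt_cost B c) (fun st' =>
    (env_of st', imem st') = sem G c (env_of st, imem st) /\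
    rmem st' = rmem (input_state s)).
Proof.
case: c => [y e|x y ea ev] /=.
  move=> w hB hr; apply: (runs_seq (T2 := 2) _ (cexprP 0 w hB hr)) => //.
  move=> st1 [k1 v1]; apply: runs_block => //=.
  by rewrite env_of_vreg v1 (keeps_env k1) (keeps_imem k1) (keeps_rmem k1).
move=> /and4P[px py wa wv] hB hr.
set N := env_of st y.
pose m i := foldl (tab_step G (env_of st) x ea ev) (imem st) (iota 0 i).
pose Inv i (st' : state R) := [/\ env_of st' = upd (env_of st) x i,
  ireg st' (treg 0) = i.+1, ireg st' (treg 1) = 1,
  imem st' = m i & rmem st' = rmem st].
have NB : N <= B by apply: hB.
apply: (runs_seq (T1 := 4) (T2 := N * (cost B ea + cost B ev + 4).+1 + 1)
  (Q1 := Inv 0)).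
- have := leq_mul NB (leqnn (cost B ea + cost B ev + 5)).
  rewrite -addnS; lia.
- apply: runs_block => //; rewrite /Inv /=.
  by rewrite !(env_of_treg, env_of_vreg) /upd !(ttE, tvE, eqxx).
move=> st1 I0.
apply: (@runs_weaken _ _ _ _ _ (Inv N)); [exact: leqnn| |apply: runs_while I0].
- by move=> st' [-> _ _ -> ->].
- move=> i st' iN [E c0 _ _ _] /=; rewrite c0 env_ofE E /upd.
  by case: eqP => // E'; exfalso; move: px py E'; rewrite /nparam; lia.
move=> i st' iN [E c0 c1 Ei Er].
apply: (runs_seq (T2 := cost B ev + 4) _ (@cexprP R s B ea 2 st' wa _ _)); first by lia.
- by rewrite E; apply: params_le_upd.
- by rewrite Er.
move=> st2 [k2 v2].
apply: (runs_seq (T2 := 4) _ (@cexprP R s B ev 3 st2 wv _ _)) => //.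
- by rewrite (keeps_env k2) E; apply: params_le_upd.
- by rewrite (keeps_rmem k2) Er.
move=> st3 [k3 v3]; apply: runs_block => //=.
have t0 : ireg st3 (treg 0) = i.+1.
  by rewrite (keeps_tmp k3) // (keeps_tmp k2).
have t1 : ireg st3 (treg 1) = 1.
  by rewrite (keeps_tmp k3) // (keeps_tmp k2).
have t2 : ireg st3 (treg 2) = eval G (env_of st') (imem st') ea.
  by rewrite (keeps_tmp k3).
have En : env_of st3 = upd (env_of st) x i.
  by rewrite (keeps_env k3) (keeps_env k2).
split.
- rewrite env_of_treg env_of_vreg.
  by rewrite [env_of (set_imem _ _ _)](_ : _ = env_of st3) // En upd_id /= t0.
- by rewrite /= /upd !(eqxx, ttE, tvE) /= t0 t1 addn1.
- by rewrite /= /upd !(eqxx, ttE, tvE) /= t1.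
- rewrite /= t2 v3 /m -addn1 iotaD foldl_cat /= -/(m i) /tab_step add0n.
  rewrite (keeps_env k2) (keeps_imem k2) (keeps_imem k3) (keeps_imem k2).
  by rewrite E Ei.
- by rewrite /= (keeps_rmem k3) (keeps_rmem k2).
Qed.

Definition cprog (l : seq stmt) : program :=
  foldr (fun c p => Seq (cstmt c) p) Skip l.

Lemma cprogP B l (st : state R) :
  all wf_stmt l -> rmem st = rmem (input_state s) ->
  safe G B l (env_of st, imem st) ->
  runs (cprog l) st (\sum_(c <- l) stmt_cost B c + 1) (fun st' =>
    (env_of st', imem st') = sems G l (env_of st, imem st)).
Proof.
elim: l st => [|c l IH] st /=.
  by move=> _ _ _; rewrite big_nil; apply: (@runs_block _ [::]).
move=> /andP[wc wl] hr [hp hs].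
have [t [st1 [e1 l1 [q1 r1]]]] := cstmtP wc hp hr.
rewrite big_cons -addnA.
apply: runs_seq (leqnn _) (ex_intro _ t (ex_intro _ st1 (And3 e1 l1 erefl))) _.
by move=> _ <-; have := IH st1 wl r1; rewrite q1; apply.
Qed.
End RunStmt.

(** * The shortest path problem *)

Section Spec.
Variables (G : geo -> rel nat) (n k : nat).

(* [lvl j i]: the row of [i] is at least [j].  The lowest point of each row is at
   least 2 above the lowest point of the row before it. *)
Fixpoint lvl (j i : nat) : bool :=
  if j is j'.+1 then [exists q : 'I_n, lvl j' q && G YGap q i] else true.

Definition row i := \sum_(j < n) lvl j.+1 i.

Definition strip r i := (row i + r) %/ k.

Lemma stripE r i : strip r i = (row i + r) %/ k. Proof. by []. Qed.

Definition less r q p :=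
  (strip r q < strip r p) || (strip r q == strip r p) &&
    (~~ G XLe p q || G XLe q p && (q < p)).

Definition rank r p := \sum_(q < n) less r q p.

Definition nthpt r t := find (fun p => rank r p == t) (iota 0 n).

(* Sets of points are coded in bijective base [n]; [insf] takes fuel [f]. *)
Fixpoint insf (f v i : nat) : bool :=
  match f, v with
  | f'.+1, u.+1 => (i == u %% n) || insf f' (u %/ n) i
  | _, _ => false
  end.

Definition ins v := insf v v.

(* A node [z] codes the set [z %/ k] and the shift [z %% k]. *)
Definition dom t z := [exists i : 'I_n, ins (z %/ k) i && G Near i (nthpt (z %% k) t)].

(* More than the cost of an optimal path, which is at most [2 * n]. *)
Definition penalty (b : bool) := if b then n + (n + 1) else 0.

(** The node entered, [z], is the one that must dominate the [t]-th point; thus layer [t.+1] answers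
    for point [t], and layer 0 for none. *)
Definition weight t u z :=
  \sum_(i < n) (ins (z %/ k) i && ~~ ins (u %/ k) i) +
  (penalty (~~ dom t z) + penalty (z %% k != u %% k)).

(** Taking the first minimiser resolves ties in the same way in this specification and in the search
    made by the program. *)
Definition argmin Z (f : nat -> nat) :=
  find (fun u => [forall v : 'I_Z, f u <= f v]) (iota 0 Z).

Fixpoint dist Z t z :=
  if t is t'.+1 then
    dist Z t' (argmin Z (fun u => dist Z t' u + weight t' u z)) +
    weight t' (argmin Z (fun u => dist Z t' u + weight t' u z)) z
  else \sum_(i < n) ins (z %/ k) i.

(* The shortest path read backwards: [walk Z a] is its node at layer [n - a]. *)
Fixpoint walk Z a :=
  if a is a'.+1 then
    argmin Z (fun u => dist Z (n - a) u + weight (n - a) u (walk Z a'))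
  else argmin Z (dist Z n).

Definition selected Z i := [exists a : 'I_n.+1, ins (walk Z a %/ k) i].

Definition walk_cost (z : nat -> nat) :=
  \sum_(i < n) ins (z 0 %/ k) i + \sum_(t < n) weight t (z t) (z t.+1).

Lemma insf_fuel f v i : v <= f -> insf f v i = ins v i.
Proof.
rewrite /ins; elim/ltn_ind: v f => -[|u] IH [|f] //= uf.
have h : u %/ n <= u by exact: leq_div.
by rewrite IH ?(IH _ _ u) //; lia.
Qed.

Lemma insS u i : ins u.+1 i = (i == u %% n) || ins (u %/ n) i.
Proof. by rewrite {1}/ins /= insf_fuel // leq_div. Qed.

(** Prepending the digit [a] to the code [v] gives [v * n + a + 1 <= (v + 1) * n], so codes of
    length [m] stay below [n.+1 ^ m]. Order and repetition of digits do not affect [ins]. *)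
Lemma ins_code (l : seq 'I_n) :
  exists2 v, v < n.+1 ^ size l & forall i : 'I_n, ins v i = (i \in l).
Proof.
elim: l => [|a l [v hv IH]] /=; first by exists 0.
have an := ltn_ord a.
exists (v * n + a).+1; first by rewrite expnS; nia.
move=> i; rewrite insS modnMDl modn_small // divnMDl ?divn_small // ?addn0.
  by rewrite IH inE.
exact: leq_ltn_trans an.
Qed.

Lemma ins_code_set m (W : {set 'I_n}) : #|W| <= m ->
  exists2 v, v < n.+1 ^ m & forall i : 'I_n, ins v i = (i \in W).
Proof.
move=> Wm; have [v hv H] := ins_code (enum W).
exists v; last by move=> i; rewrite H mem_enum.
by apply: leq_trans hv _; rewrite -cardE leq_pexp2l.
Qed.

Lemma argminP Z (f : nat -> nat) : 0 < Z ->
  argmin Z f < Z /\ forall u, u < Z -> f (argmin Z f) <= f u.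
Proof.
move=> Z0; set p := fun u => [forall v : 'I_Z, f u <= f v].
have : has p (iota 0 Z).
  case: (@arg_minnP _ (Ordinal Z0) xpredT (fun i : 'I_Z => f i) isT) => i _ H.
  apply/hasP; exists (i : nat); first by rewrite mem_iota add0n ltn_ord.
  by apply/forallP => v; apply: H.
move=> hp; move: (hp); rewrite has_find size_iota => lt; split=> // u uZ.
have := nth_find 0 hp; rewrite nth_iota // add0n => /forallP/(_ (Ordinal uZ)).
by [].
Qed.

(** Bellman's inequality, applied along an arbitrary path. *)
Lemma dist_min Z t (z : nat -> nat) : 0 < Z -> (forall t, z t < Z) ->
  dist Z t (z t) <=
  \sum_(i < n) ins (z 0 %/ k) i + \sum_(i < t) weight i (z i) (z i.+1).
Proof.
move=> Z0 zZ; elim: t => [|t IH] /=; first by rewrite big_ord0 addn0.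
rewrite big_ord_recr /= addnA.
set f := fun u => dist Z t u + weight t u (z t.+1).
apply: leq_trans (proj2 (argminP f Z0) _ (zZ t)) _.
by rewrite /f leq_add2r.
Qed.

Lemma walk_lt Z a : 0 < Z -> walk Z a < Z.
Proof. by case: a => [|a] Z0 /=; exact: (proj1 (argminP _ Z0)). Qed.

(** The walk attains the distance: each backward step unfolds one level of [dist] at its minimiser
    and pays exactly one edge. *)
Lemma dist_walk Z a : a <= n ->
  dist Z n (walk Z 0) = dist Z (n - a) (walk Z a) +
    \sum_(n - a <= i < n) weight i (walk Z (n - i)) (walk Z (n - i.+1)).
Proof.
elim: a => [|a IH] an; first by rewrite subn0 big_geq // addn0.
rewrite IH; last exact: ltnW.
have E : n - a = (n - a.+1).+1 by lia.
rewrite (big_ltn (_ : n - a.+1 < n)) -?E; last by lia.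
rewrite addnA; congr (_ + _); rewrite {1}E [dist _ _.+1 _]/=.
have -> : n - (n - a.+1) = a.+1 by lia.
by have -> : n - (n - a) = a by lia.
Qed.

Lemma dist_walk_cost Z :
  dist Z n (walk Z 0) = walk_cost (fun t => walk Z (n - t)).
Proof.
by rewrite (dist_walk Z (leqnn n)) subnn big_mkord /walk_cost subn0.
Qed.

Lemma sum_nat_bool m (f : 'I_m -> bool) : \sum_(i < m) f i = #|[set i | f i]|.
Proof.
rewrite -sum1dep_card [RHS]big_mkcond /=; apply: eq_bigr => i _.
by case: (f i).
Qed.

(** A selected point lies in the first set or enters at some transition, and it is paid for there.
    The induction is on prefixes of the walk. *)
Lemma selected_walk_cost Z :
  #|[set i : 'I_n | selected Z i]| <= walk_cost (fun t => walk Z (n - t)).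
Proof.
rewrite /walk_cost; pose z t := walk Z (n - t).
have H t : t <= n -> #|[set i : 'I_n | [exists a : 'I_t.+1, ins (z a %/ k) i]]|
   <= \sum_(i < n) ins (z 0 %/ k) i + \sum_(i < t) weight i (z i) (z i.+1).
  elim: t => [|t IH] tn.
    rewrite big_ord0 addn0 sum_nat_bool; apply/subset_leq_card/subsetP => i.
    by rewrite !inE => /existsP[a]; rewrite ord1.
  rewrite big_ord_recr /= addnA.
  apply: leq_trans (leq_add (IH (ltnW tn)) (leq_addr _ _)).
  rewrite [X in _ + X]sum_nat_bool.
  apply: leq_trans (leq_card_setU _ _); apply/subset_leq_card/subsetP => i.
  rewrite !inE => /existsP[a ia].
  case: (ltnP a t.+1) => [at1|ta].
    by apply/orP; left; apply/existsP; exists (Ordinal at1).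
  have {ta} ea : nat_of_ord a = t.+1 by have := ltn_ord a; lia.
  rewrite ea in ia; rewrite ia /=.
  case: (boolP (ins (z t %/ k) i)) => [h|]; rewrite ?orbT //.
  by rewrite orbF; apply/existsP; exists ord_max.
apply: leq_trans _ (H n (leqnn n)); apply/subset_leq_card/subsetP => i.
rewrite !inE => /existsP[a ia]; apply/existsP; exists (rev_ord a).
have -> : z (rev_ord a) = walk Z a; last by [].
by rewrite /z /=; congr walk; have := ltn_ord a; lia.
Qed.

(** A single penalty would already exceed [n + n]. Hence all nodes share the shift of [walk Z 0],
    and every layer dominates its point in the order of that one shift. *)
Lemma walk_dom Z t : t < n -> dist Z n (walk Z 0) <= n + n ->
  [exists i : 'I_n, ins (walk Z (n - t.+1) %/ k) i &&
                    G Near i (nthpt (walk Z 0 %% k) t)].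
Proof.
move=> tn; rewrite dist_walk_cost /walk_cost => H.
have P i : i < n -> penalty (~~ dom i (walk Z (n - i.+1))) = 0 /\
    penalty (walk Z (n - i.+1) %% k != walk Z (n - i) %% k) = 0.
  move=> ii; have : weight i (walk Z (n - i)) (walk Z (n - i.+1)) <= n + n.
    apply: leq_trans H; apply: leq_trans (leq_addl _ _).
    by rewrite (bigD1 (Ordinal ii)) //= leq_addr.
  by rewrite /weight /penalty; case: (~~ dom _ _); case: (_ != _) => /=; lia.
have E a : a <= n -> walk Z a %% k = walk Z 0 %% k.
  elim: a => // a IH an; rewrite -(IH (ltnW an)).
  have lt_n : n - a.+1 < n by lia.
  have [_] := P _ lt_n.
  have -> : n - (n - a.+1).+1 = a by lia.
  have -> : n - (n - a.+1) = a.+1 by lia.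
  by rewrite /penalty; case: eqP => // _ /eqP; lia.
have [+ _] := P t tn; rewrite /penalty.
case: (boolP (dom _ _)) => [|_ /= /eqP]; last by lia.
by rewrite /dom E // leq_subr.
Qed.

End Spec.

(** * Rows, strips and packing *)

(** The indices where [f] holds form an initial segment, whose length below [n] is the sum. *)
Lemma sum_decreasing n (f : nat -> bool) :
  (forall j, f j.+1 -> f j) -> forall j, j < n -> f j = (j < \sum_(i < n) f i).
Proof.
move=> dec; have allf j : f j -> forall i, i <= j -> f i.
  elim: j => [|j IH] fj i; first by rewrite leqn0 => /eqP ->.
  by rewrite leq_eqVlt => /predU1P[->//|]; apply: IH; apply: dec.
elim: n => // n IH j jn; rewrite big_ord_recr /=.
case fn: (f n) => /=.
  have -> : \sum_(i < n) f i = n.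
    transitivity (\sum_(i < n) 1); last by rewrite sum1_card card_ord.
    by apply: eq_bigr => i _; rewrite (allf n fn i) // ltnW.
  by rewrite (allf n fn j) //; lia.
rewrite addn0; have [->|ne] := eqVneq j n; last by apply: IH; lia.
rewrite fn; apply/esym/negbTE; rewrite -leqNgt.
rewrite -[X in _ <= X]card_ord -sum1_card.
by apply: leq_sum => i _; case: (f i).
Qed.

Lemma sqr_sum_le1 (R : realDomainType) (a b : R) :
  (a ^+ 2 + b ^+ 2 <= 1 -> -1 <= a <= 1)%R.
Proof.
move=> h; rewrite -ler_norml -(@expr_le1 _ 2) // -normrX ger0_norm ?sqr_ge0 //.
by apply: le_trans h; rewrite lerDl sqr_ge0.
Qed.

Section Geometry.
Variables (R : realType) (s : seq (R * R)) (k : nat).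
Local Notation n := (size s).
Local Notation G := (pt_rel s).
Local Notation near := (pt_rel s Near).
Local Notation x i := (nth (0, 0)%R s i).1.
Local Notation y i := (nth (0, 0)%R s i).2.
Local Notation lvl := (lvl G n).
Local Notation row := (row G n).
Local Notation strip := (strip G n k).
Local Notation less := (less G n k).
Local Notation rank := (rank G n k).
Local Notation nthpt := (nthpt G n k).

Lemma near_refl i : near i i.
Proof. by rewrite /= !subrr expr0n /= addr0 ler01. Qed.

Lemma near_sym i j : near i j = near j i.
Proof. by rewrite /= -[in LHS]sqrrN opprB -[X in (_ + X <= _)%R]sqrrN opprB. Qed.

Lemma near_x i j : near i j -> (x j - 1 <= x i <= x j + 1)%R.
Proof. by move=> /sqr_sum_le1/andP[h1 h2]; apply/andP; split; lra. Qed.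

Lemma near_y i j : near i j -> (y j - 1 <= y i <= y j + 1)%R.
Proof. by rewrite /= addrC => /sqr_sum_le1/andP[h1 h2]; apply/andP; split; lra. Qed.

Lemma lvlSP j i : reflect
  (exists2 q, q < n & lvl j q /\ (y q + 2 <= y i)%R) (lvl j.+1 i).
Proof.
apply: (iffP existsP) => [[q /andP[h g]]|[q qn [h g]]]; first by exists q.
by exists (Ordinal qn); apply/andP.
Qed.

Lemma lvl_dec j i : lvl j.+1 i -> lvl j i.
Proof.
by elim: j i => [//|j IH] i /lvlSP[q qn [/IH h g]]; apply/lvlSP; exists q.
Qed.

Lemma lvl_up j a b : lvl j a -> (y a <= y b)%R -> lvl j b.
Proof.
case: j => // j /lvlSP[q qn [h g]] ab; apply/lvlSP; exists q => //.
by split=> //; apply: le_trans ab.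
Qed.

(** Along a chain with gaps at least 2, the set of points no higher than the current one grows
    strictly. So truncating the sum in [row] at [n] loses nothing. *)
Lemma lvl_lt j i : i < n -> lvl j i -> j < n.
Proof.
pose S i := [set q : 'I_n | (y q <= y i)%R].
suff H : lvl j i -> i < n -> j < #|S i|.
  move=> lin /H/(_ lin) h; apply: leq_trans h _.
  by rewrite -[X in _ <= X]card_ord max_card.
elim: j i => [|j IH] i.
  by move=> _ lin; apply/card_gt0P; exists (Ordinal lin); rewrite inE.
case/lvlSP => q qn [/IH/(_ qn) h g] lin; apply: leq_ltn_trans h _.
apply: proper_card; apply/properP; split.
  by apply/subsetP => p; rewrite !inE => h; lra.
by exists (Ordinal lin); rewrite inE ?lexx // -ltNge /=; lra.
Qed.

Lemma row_lt i : i < n -> row i < n.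
Proof.
move=> lin; have n0 : 0 < n by lia.
have h : lvl n.-1.+1 i = (n.-1 < row i).
  by apply: (@sum_decreasing n (fun j => lvl j.+1 i)) => [j|]; [exact: lvl_dec|lia].
case: (ltnP n.-1 (row i)) h => [_ /(lvl_lt lin)|]; lia.
Qed.

Lemma lvlE j i : i < n -> lvl j i = (j <= row i).
Proof.
move=> lin; case: j => [//|j]; case: (ltnP j n) => jn.
  exact: (@sum_decreasing n (fun j => lvl j.+1 i) (fun j => @lvl_dec j.+1 i)).
have := row_lt lin => rn; rewrite [RHS](_ : _ = false); last by lia.
by case h: (lvl j.+1 i) => //; have := lvl_lt lin h; lia.
Qed.

(** Otherwise [a] itself would lift [b] to the next level. *)
Lemma row_eq_lt a b : a < n -> b < n -> row a = row b -> (y b < y a + 2)%R.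
Proof.
move=> an bn E; rewrite ltNge; apply/negP => h.
suff : lvl (row a).+1 b by rewrite lvlE // E ltnn.
by apply/lvlSP; exists a; rewrite // lvlE.
Qed.

(** The chain below [b] contains a point [q] of level [row a + 1] at least 2 lower than [b], and [q]
    is strictly above [a], since levels are monotone in height. *)
Lemma row_far a b : a < n -> b < n -> row a + 2 <= row b -> (y a + 2 < y b)%R.
Proof.
move=> an bn; rewrite addn2 -lvlE // => /lvlSP[q qn [hq g]].
apply: lt_le_trans g; rewrite ltrD2r ltNge; apply/negP => h.
by have := lvl_up hq h; rewrite lvlE // ltnn.
Qed.

(** A unit disk has vertical extent 2, which is too little to reach a row two further up. *)
Lemma near_row q a b : a < n -> b < n -> near q a -> near q b ->
  row b <= (row a).+1.
Proof.
move=> an bn /near_y qa /near_y qb; rewrite leqNgt; apply/negP => h.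
by have := @row_far a b an bn; rewrite addn2 => /(_ h); lra.
Qed.

Lemma lessP r q p : reflect
  (strip r q < strip r p \/ strip r q = strip r p /\
    ((x q < x p)%R \/ x q = x p /\ q < p)) (less r q p).
Proof.
apply: (iffP orP) => [[|/andP[/eqP e /orP[h|/andP[h1 h2]]]]|
  [|[-> [h|[h1 h2]]]]]; first by left.
- by right; split=> //; left; rewrite ltNge.
- right; split=> //; case: (ltgtP (x q) (x p)) => h; [by left| |by right].
  by move: h1 => /=; lra.
- by left.
- by right; rewrite eqxx /= -ltNge h.
- by right; rewrite eqxx /= h1 lexx h2 orbT.
Qed.

Lemma less_irr r p : less r p p = false.
Proof. by apply/negP => /lessP [|[_ [|[]]]]; rewrite ?ltnn ?ltxx. Qed.

Lemma less_trans r a b c : less r a b -> less r b c -> less r a c.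
Proof.
move=> /lessP h1 /lessP h2; apply/lessP.
case: h1 h2 => [h1|[-> h1]] [h2|[e2 h2]]; first by left; lia.
- by left; rewrite -e2.
- by left.
right; split=> //; case: h1 h2 => [h1|[-> h1]] [h2|[e h2]].
- by left; lra.
- by left; rewrite -e.
- by left.
- by right; split; rewrite ?e //; lia.
Qed.

Lemma less_total r a b : a != b -> less r a b || less r b a.
Proof.
move=> ne; apply/orP.
case: (ltgtP (strip r a) (strip r b)) => hs; first by left; apply/lessP; left.
  by right; apply/lessP; left.
case: (ltgtP (x a) (x b)) => hx; first by left; apply/lessP; right; split=> //; left.
  by right; apply/lessP; right; split=> //; left.
by case: (ltgtP a b) ne => // h _; [left|right]; apply/lessP; right; split=> //;
  right.
Qed.

Lemma rankE r p : rank r p = #|[set q : 'I_n | less r q p]|.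
Proof. exact: sum_nat_bool. Qed.

Lemma rank_less r a b : a < n -> less r a b -> rank r a < rank r b.
Proof.
move=> an ab; rewrite !rankE; apply: proper_card; apply/properP; split.
  by apply/subsetP => q; rewrite !inE => qa; apply: less_trans ab.
by exists (Ordinal an); rewrite inE ?less_irr.
Qed.

Lemma rank_inj r a b : a < n -> b < n -> rank r a = rank r b -> a = b.
Proof.
move=> an bn E; apply/eqP/negPn/negP => /(less_total r)/orP[] h.
  by have := rank_less an h; rewrite E ltnn.
by have := rank_less bn h; rewrite E ltnn.
Qed.

Lemma rank_lt r a : a < n -> rank r a < n.
Proof.
move=> an; rewrite rankE -[X in _ < X]card_ord -cardsT; apply: proper_card.
apply/properP; split; first exact: subsetT.
by exists (Ordinal an); rewrite inE ?less_irr.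
Qed.

Lemma nthpt_rank r p : p < n -> nthpt r (rank r p) = p.
Proof.
move=> pn; set a := fun p' => rank r p' == rank r p.
have hp : has a (iota 0 n) by apply/hasP; exists p; rewrite /a ?mem_iota.
move: (hp); rewrite has_find size_iota => lt.
have := nth_find 0 hp; rewrite nth_iota // add0n => /eqP.
by apply: rank_inj.
Qed.

(** An injection of ['I_n] into itself is onto, so the search in [nthpt] succeeds. *)
Lemma nthptP r t : t < n -> nthpt r t < n /\ rank r (nthpt r t) = t.
Proof.
move=> tn; pose f (p : 'I_n) := Ordinal (rank_lt r (ltn_ord p)).
have f_inj : injective f by move=> a b [] /rank_inj h; apply: val_inj; apply: h.
have /codomP[p /(congr1 val)/= ->] := injF_onto f_inj (Ordinal tn).
by rewrite nthpt_rank.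
Qed.

Lemma rank_strip r a b : a < n -> b < n -> rank r a <= rank r b ->
  strip r a <= strip r b /\ (strip r a = strip r b -> (x a <= x b)%R).
Proof.
move=> an bn h; have {h} : (a = b) \/ less r a b.
  case: (eqVneq a b) => [|ne]; [by left|right].
  case/orP: (less_total r ne) => // /(rank_less bn); lia.
case=> [->//|/lessP[h|[-> [h|[-> _]]]] //]; last by split=> // _; apply: ltW.
by split; [exact: ltnW|lia].
Qed.

(* Residue modulo 16 of the index of a cell of side 1/2: it identifies the cell
   among those meeting an interval of length 7. *)
Definition cell (a : R) : 'I_16 := inord `|(Num.floor (2 * a)%R %% 16)%Z|.

(** The two floors differ by less than 16 and are congruent modulo 16, hence equal. *)
Lemma cell_eq a b : (a - 7 < b < a + 7)%R -> cell a = cell b ->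
  (- (1 / 2) < a - b < 1 / 2)%R.
Proof.
rewrite /cell => ab /(congr1 val) /=; rewrite !inordK; [|lia|lia].
set u := Num.floor _; set v := Num.floor _ => E.
have /andP[u1 u2] := floor_itv (2 * a)%R; have /andP[v1 v2] := floor_itv (2 * b)%R.
move: u1 u2 v1 v2; rewrite -/u -/v !intrD => u1 u2 v1 v2.
have h1 : (u - v < 16)%R by rewrite -(ltr_int R) intrB /=; lra.
have h2 : (- 16 < u - v)%R by rewrite -(ltr_int R) intrB /=; lra.
have uv : u = v by lia.
by rewrite uv in u1 u2; lra.
Qed.

(** A point is determined by the row of its anchor [p], one of [k] in the strip, and the cells of
    its two coordinates. Anchors in one row differ by less than 2 in height, so their points differ
    by less than 6 vertically and by at most 4 horizontally: within 7, cells are unambiguous. Two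
    points with equal data differ by less than 1/2 in both coordinates, so they are near. *)
Lemma packing (I : {set 'I_n}) r c (a : R) : 0 < k ->
  (forall i, i \in I -> exists p : 'I_n,
     [/\ strip r p = c, (a - 2 <= x i <= a + 2)%R & (y p - 2 <= y i <= y p + 2)%R]) ->
  (forall i j, i \in I -> j \in I -> i != j -> ~~ near i j) ->
  #|I| <= 256 * k.
Proof.
move=> k_gt0 HI sep.
pose ok (i p : 'I_n) := [&& strip r p == c, (a - 2 <= x i <= a + 2)%R &
   (y p - 2 <= y i <= y p + 2)%R].
have okP i : i \in I -> exists p, ok i p.
  by move=> /HI[p [h1 h2 h3]]; exists p; apply/and3P; split=> //; apply/eqP.
pose anchor i := odflt i [pick p | ok i p].
have anchorP i : i \in I -> ok i (anchor i).
  move=> /okP[p hp]; rewrite /anchor; case: pickP => [//|/(_ p)]; by rewrite hp.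
pose f i := (Ordinal (ltn_pmod (row (anchor i) + r) k_gt0), (cell (x i), cell (y i))).
have f_inj : {in I &, injective f}.
  move=> i j iI jI [] Em Ex Ey; apply/eqP/negPn/negP => /(sep _ _ iI jI)/negP; apply.
  have /and3P[/eqP si xi yi] := anchorP _ iI.
  have /and3P[/eqP sj xj yj] := anchorP _ jI.
  have Er : row (anchor i) = row (anchor j).
    move: si sj; rewrite !stripE => si sj.
    apply/eqP; rewrite -(eqn_add2r r) (divn_eq (_ + r) k) si Em -sj -divn_eq //.
  have h1 := row_eq_lt (ltn_ord _) (ltn_ord _) Er.
  have h2 := row_eq_lt (ltn_ord _) (ltn_ord _) (esym Er).
  have hx : (x i - 7 < x j < x i + 7)%R by apply/andP; split; lra.
  have hy : (y i - 7 < y j < y i + 7)%R by apply/andP; split; lra.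
  have /andP[x1 x2] := cell_eq hx Ex; have /andP[y1 y2] := cell_eq hy Ey.
  rewrite /=; nra.
rewrite -(card_in_imset f_inj); apply: leq_trans (max_card _) _.
by rewrite !card_prod !card_ord mulnC.
Qed.

End Geometry.

(** * Windows of an optimal solution *)

Section Window.
Variables (R : realType) (s : seq (R * R)) (k : nat).
Hypothesis k_gt0 : 0 < k.
Local Notation n := (size s).
Local Notation G := (pt_rel s).
Local Notation near := (pt_rel s Near).
Local Notation x i := (nth (0, 0)%R s i).1.
Local Notation y i := (nth (0, 0)%R s i).2.
Local Notation row := (row G n).
Local Notation strip := (strip G n k).
Local Notation rank := (rank G n k).
Local Notation nthpt := (nthpt G n k).

Definition dominates (D : {set 'I_n}) := forall p : 'I_n, exists2 q, q \in D & near q p.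

Definition minimum_dominates (D : {set 'I_n}) :=
  dominates D /\ forall D', dominates D' -> #|D| <= #|D'|.

Lemma minimum_dominates_exists : exists D, minimum_dominates D.
Proof.
pose b (D : {set 'I_n}) := [forall p : 'I_n, [exists q in D, near q p]].
have bP D : reflect (dominates D) (b D).
  by apply: (iffP forallP) => H p; have /exists_inP := H p.
have b0 : b setT.
  by apply/bP => p; exists p; [rewrite inE|exact: near_refl].
case: (arg_minnP (fun D : {set 'I_n} => #|D|) b0) => D /bP bD H.
by exists D; split=> // D' /bP; apply: H.
Qed.

(* Exchange argument: [A] may be replaced in a minimum dominating set by a
   maximal separated subset [I] of the points which it dominates. *)
Lemma exchange (D A : {set 'I_n}) : minimum_dominates D -> A \subset D ->
  exists I : {set 'I_n}, [/\ #|A| <= #|I|,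
    forall i, i \in I -> exists2 q, q \in A & near q i &
    forall i j, i \in I -> j \in I -> i != j -> ~~ near i j].
Proof.
move=> [domD minD] AD.
pose N := [set i : 'I_n | [exists q in A, near q i]].
pose ok (I : {set 'I_n}) := (I \subset N) &&
  [forall i in I, [forall j in I, (i != j) ==> ~~ near i j]].
have ok0 : ok set0.
  by rewrite /ok sub0set; apply/forall_inP => i; rewrite inE.
have [I] := @maxset_exists _ ok set0 ok0.
move=> /maxsetP[/andP[IN /forall_inP sep] maxI] _.
have sepP i j : i \in I -> j \in I -> i != j -> ~~ near i j.
  by move=> iI jI ne; have /forall_inP/(_ j jI)/implyP := sep i iI; apply.
have NP i : i \in N -> exists2 q, q \in A & near q i.
  by rewrite inE => /exists_inP.
exists I; split=> //; last by move=> i /(subsetP IN)/NP.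
have domN i : i \in N -> exists2 q, q \in I & near q i.
  move=> iN; case: (boolP (i \in I)) => iI; first by exists i => //; apply: near_refl.
  case: (boolP [exists q in I, near q i]) => [/exists_inP//|].
  rewrite negb_exists_in => /forall_inP far; case/negP: iI.
  rewrite -(maxI (i |: I)); [by rewrite setU11| |exact: subsetUr].
  apply/andP; split; first by rewrite subUset sub1set iN.
  apply/forall_inP => a aI; apply/forall_inP => b bI; apply/implyP.
  move: aI bI; rewrite !inE => /predU1P[->|aI] /predU1P[->|bI]; rewrite ?eqxx // => ne.
  - by rewrite near_sym; apply: far.
  - exact: far.
  - exact: sepP.
have : #|D| <= #|(D :\: A) :|: I|.
  apply: minD => p; have [q qD qp] := domD p; case: (boolP (q \in A)) => qA.
    have [|q' q'I q'p] := domN p; first by rewrite inE; apply/exists_inP; exists q.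
    by exists q' => //; rewrite inE q'I orbT.
  by exists q => //; rewrite !inE qA qD.
move=> h; have := leq_trans h (leq_card_setU _ _).
by rewrite cardsD (setIidPr AD); have := subset_leq_card AD; lia.
Qed.

(** The inequalities are weak so that a point dominating the [t]-th point always qualifies, with [a]
    and [b] both equal to it. Having witnesses on both sides confines the window horizontally. *)
Definition window r (D : {set 'I_n}) t : {set 'I_n} :=
  [set q in D | [exists a : 'I_n, [exists b : 'I_n,
    [&& near q a, near q b, strip r a == strip r (nthpt r t),
        strip r b == strip r (nthpt r t) & rank r a <= t <= rank r b]]]].

(** Starting from the empty set makes the initial node free, so that the cost of the path counts
    entries only. *)
Definition windows r (D : {set 'I_n}) t := if t is t'.+1 then window r D t' else set0.

Lemma windowP r (D : {set 'I_n}) t (q : 'I_n) : reflect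
  [/\ q \in D & exists a b : 'I_n, [/\ near q a, near q b,
     strip r a = strip r (nthpt r t), strip r b = strip r (nthpt r t) &
     rank r a <= t <= rank r b]] (q \in window r D t).
Proof.
rewrite inE; apply: (iffP andP) => [[qD /existsP[a /existsP[b]]]|
  [qD [a [b [h1 h2 h3 h4 h5]]]]].
  by move=> /and5P[h1 h2 /eqP h3 /eqP h4 h5]; split=> //; exists a, b.
split=> //; apply/existsP; exists a; apply/existsP; exists b.
by apply/and5P; split=> //; apply/eqP.
Qed.

(** The exchanged points are at distance at most 1 from the window. The earlier witness [a] bounds
    their abscissa from above, the later one [b] from below, each with slack 1 + 1; [a] also serves
    as the anchor for their height. *)
Lemma window_card r (D : {set 'I_n}) t : minimum_dominates D -> t < n ->
  #|window r D t| <= 256 * k.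
Proof.
move=> minD tn; set W := window r D t.
have WD : W \subset D by apply/subsetP => q /windowP[].
have [I [WI near_I sep]] := exchange minD WD.
apply: leq_trans WI _.
have [ptn rkt] := nthptP k r tn.
apply: (packing k_gt0 (r := r) (c := strip r (nthpt r t)) (a := x (nthpt r t)) _ sep).
move=> i /near_I[q /windowP[_ [a [b [qa qb sa sb /andP[ra rb]]]]] qi].
exists a; split=> //; last first.
  by move: (near_y qa) (near_y qi) => /andP[? ?] /andP[? ?]; apply/andP; split; lra.
have [|_ /(_ sa) xa] := @rank_strip _ s k r a (nthpt r t) (ltn_ord a) ptn.
  by rewrite rkt.
have [|_ /(_ (esym sb)) xb] := @rank_strip _ s k r (nthpt r t) b ptn (ltn_ord b).
  by rewrite rkt.
move: (near_x qa) (near_x qb) (near_x qi) => /andP[? ?] /andP[? ?] /andP[? ?].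
by apply/andP; split; lra.
Qed.

Lemma window_dom r (D : {set 'I_n}) t : dominates D -> t < n ->
  exists2 q, q \in window r D t & near q (nthpt r t).
Proof.
move=> domD tn; have [ptn rkt] := nthptP k r tn.
have [q qD qp] := domD (Ordinal ptn); exists q => //.
apply/windowP; split=> //; exists (Ordinal ptn), (Ordinal ptn).
by split=> //=; rewrite rkt leqnn.
Qed.

Definition entries r (D : {set 'I_n}) q :=
  [set t : 'I_n | (q \in windows r D t.+1) && (q \notin windows r D t)].

(** If [a] came before [t], the point just before [t] would lie between [a] and [t] in the order,
    hence in the same strip, and [q] would already be in its window. *)
Lemma entry_first r (D : {set 'I_n}) q (t : 'I_n) (a : 'I_n) : t \in entries r D q ->
  near q a -> strip r a = strip r (nthpt r t) -> t <= rank r a.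
Proof.
rewrite inE => /andP[/windowP[qD [a0 [b0 [qa0 qb0 sa0 sb0 /andP[ra0 rb0]]]]]].
case: t ra0 rb0 sa0 sb0 => t tn /= ra0 rb0 sa0 sb0.
case: t => [//|t] in tn ra0 rb0 sa0 sb0 *.
move=> /= qW qa sa; rewrite leqNgt; apply/negP => ra; case/windowP: qW.
split=> //; exists a, b0.
have [ptn rkt] := nthptP k r (ltnW tn); have [ptn1 rkt1] := nthptP k r tn.
have [|h1 _] := @rank_strip _ s k r a (nthpt r t) (ltn_ord a) ptn.
  by rewrite rkt.
have [|h2 _] := @rank_strip _ s k r (nthpt r t) (nthpt r t.+1) ptn ptn1.
  by rewrite rkt rkt1.
have e : strip r (nthpt r t) = strip r (nthpt r t.+1) by lia.
by rewrite e; split=> //; apply/andP; split; lia.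
Qed.

(** Each of the two times is at most the rank of a point witnessing the other. *)
Lemma entries_inj r (D : {set 'I_n}) q (t1 t2 : 'I_n) :
  t1 \in entries r D q -> t2 \in entries r D q ->
  strip r (nthpt r t1) = strip r (nthpt r t2) -> t1 = t2.
Proof.
move=> e1 e2 E; have first t : t \in entries r D q -> exists a : 'I_n,
    [/\ near q a, strip r a = strip r (nthpt r t) & rank r a <= t].
  by rewrite inE => /andP[/windowP[_ [a [b [? _ ? _ /andP[? _]]]]] _]; exists a.
have [a [qa sa ra]] := first _ e1; have [b [qb sb rb]] := first _ e2.
apply: val_inj => /=; apply/eqP; rewrite eqn_leq.
rewrite (leq_trans (entry_first e1 qb _) rb) ?sb //.
by rewrite (leq_trans (entry_first e2 qa _) ra) ?sa.
Qed.

(** [j] is the lowest row that the disk of [q] meets; the only other candidate is [j + 1]. The bound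
    is written as a difference of quotients, with [j] independent of [r], so that it telescopes over
    the shifts. *)
Lemma entries_card (q : 'I_n) : exists j, forall r (D : {set 'I_n}),
  #|entries r D q| <= 1 + ((j + r.+1) %/ k - (j + r) %/ k).
Proof.
case: (@arg_minnP _ q (fun a : 'I_n => near q a) (fun a => row a) (near_refl s q)).
move=> p qp minp; exists (row p) => r D.
pose f (t : 'I_n) := strip r (nthpt r t).
set u := (row p + r) %/ k; set v := (row p + r.+1) %/ k.
have fE t : t \in entries r D q -> f t = u \/ f t = v.
  rewrite inE => /andP[/windowP[_ [a [b [qa _ sa _ _]]]] _].
  rewrite /f -sa stripE; have := minp a qa.
  have := near_row (ltn_ord p) (ltn_ord a) qp qa; rewrite /u /v => h1 h2.
  have [->|->] : row a = row p \/ row a = (row p).+1 by lia.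
    by left.
  by right; rewrite addSnnS.
have uv : u <= v by apply: leq_div2r; lia.
rewrite cardE -(size_map f); have un : uniq (map f (enum (entries r D q))).
  rewrite map_inj_in_uniq ?enum_uniq // => a b; rewrite !mem_enum.
  exact: entries_inj.
have [e|ne] := eqVneq u v.
  rewrite -e subnn addn0; apply: (uniq_leq_size un (s2 := [:: u])) => z.
  by case/mapP => t; rewrite mem_enum => /fE[] -> ->; rewrite inE ?e eqxx.
apply: leq_trans (uniq_leq_size un (s2 := [:: u; v]) _) _ => /=; last by lia.
move=> z /mapP[t]; rewrite mem_enum => /fE[] -> ->; by rewrite !inE eqxx ?orbT.
Qed.

Lemma entries_sum (D : {set 'I_n}) (q : 'I_n) :
  \sum_(r < k) #|entries r D q| <= k.+1.
Proof.
have [j H] := entries_card q.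
apply: (@leq_trans (\sum_(r < k) (1 + ((j + r.+1) %/ k - (j + r) %/ k)))).
  by apply: leq_sum => r _; apply: H.
rewrite big_split /= sum1_card card_ord -addn1 leq_add2l.
rewrite -(big_mkord xpredT (fun r => (j + r.+1) %/ k - (j + r) %/ k)).
rewrite (@telescope_sumn 0 k (fun r => (j + r) %/ k)); last first.
  by move=> a b ab; apply: leq_div2r; rewrite leq_add2l.
by rewrite addn0 divnDr ?dvdnn // divnn k_gt0; lia.
Qed.

Definition drift r (D : {set 'I_n}) :=
  \sum_(t < n) #|windows r D t.+1 :\: windows r D t|.

(** Double counting of the pairs of a time and a point entering then. *)
Lemma driftE r (D : {set 'I_n}) : drift r D = \sum_(q in D) #|entries r D q|.
Proof.
transitivity (\sum_(t < n) \sum_(q in D)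
    ((q \in windows r D t.+1) && (q \notin windows r D t))).
  apply: eq_bigr => t _; rewrite -sum1_card big_mkcond [RHS]big_mkcond /=.
  apply: eq_bigr => q _; rewrite in_setD andbC.
  case: (boolP (q \in window r D t)) => [/windowP[-> _] /=|_]; last first.
    by case: ifP.
  by case: (q \in windows r D t).
rewrite exchange_big; apply: eq_bigr => q _.
by rewrite sum_nat_bool.
Qed.

Lemma good_shift (D : {set 'I_n}) : exists2 r, r < k & k * drift r D <= k.+1 * #|D|.
Proof.
have H : \sum_(r < k) drift r D <= k.+1 * #|D|.
  under eq_bigr do rewrite driftE.
  rewrite exchange_big /= mulnC -sum_nat_const.
  by apply: leq_sum => q _; apply: entries_sum.
case: (@arg_minnP _ (Ordinal k_gt0) xpredT (fun r : 'I_k => drift r D) isT) => r _ min.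
exists r => //; apply: leq_trans H; rewrite -[X in X * _]card_ord -sum_nat_const.
by apply: leq_sum => i _; apply: min.
Qed.

Lemma good_walk (D : {set 'I_n}) V : minimum_dominates D -> n.+1 ^ (256 * k) <= V ->
  exists2 z, (forall t, z t < V * k) &
             k * walk_cost G n k z <= k.+1 * #|D|.
Proof.
move=> minD hV; have [r rk hr] := good_shift D.
(* [choice] needs a code at every time, but windows are bounded only up to [n]; beyond that the
   empty set is used. *)
have hW t : #|if t < n.+1 then windows r D t else set0| <= 256 * k.
  case: t => [|t]; first by rewrite /= cards0.
  rewrite ltnS; case: ltnP => tn; last by rewrite cards0.
  exact: window_card.
have H t : exists v, v < V /\ forall i : 'I_n,
    ins n v i = (i \in if t < n.+1 then windows r D t else set0).
  have [v hv vE] := ins_code_set (hW t).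
  by exists v; split=> //; apply: leq_trans hV.
have [v vP] := choice H.
have div_z t : (v t * k + r) %/ k = v t by rewrite divnMDl // divn_small ?addn0.
have mod_z t : (v t * k + r) %% k = r by rewrite modnMDl modn_small.
exists (fun t => v t * k + r) => [t|].
  by case: (vP t) => hv _; nia.
suff -> : walk_cost G n k (fun t => v t * k + r) = drift r D by [].
rewrite /walk_cost big1 ?add0n => [|i _]; last first.
  by rewrite div_z (proj2 (vP 0)) inE.
apply: eq_bigr => t _; have tn := ltn_ord t.
have vE t' (i : 'I_n) : t' <= n -> ins n (v t') i = (i \in windows r D t').
  by move=> h; rewrite (proj2 (vP t')) ltnS h.
rewrite /weight !div_z !mod_z eqxx /= addn0.
have -> : dom G n k t (v t.+1 * k + r).
  apply/existsP; have [q qW qt] := window_dom r (proj1 minD) tn.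
  by exists q; rewrite div_z mod_z vE // qW.
rewrite /= addn0 sum_nat_bool; congr #|pred_of_set _|; apply/setP => i.
by rewrite in_setD [LHS]inE !vE ?(ltnW tn) // andbC.
Qed.

End Window.

(** * The program *)

(* Locking keeps unification from unfolding these expressions into one another. *)
Definition notE e := locked (Ite e (Cst 0) (Cst 1)).
Definition andE e1 e2 := locked (Ite e1 (Ite e2 (Cst 1) (Cst 0)) (Cst 0)).
Definition orE e1 e2 := locked (Ite e1 (Cst 1) (Ite e2 (Cst 1) (Cst 0))).
Definition leE e1 e2 := locked (notE (Sub e1 e2)).
Definition ltE e1 e2 := locked (leE (Add e1 (Cst 1)) e2).
Definition eqE e1 e2 := locked (andE (leE e1 e2) (leE e2 e1)).
Definition mulE e y := locked (Bind 80 e (Sum 81 y (Var 80))).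
Definition divE e y b := locked
  (Bind 82 e (Sum 83 b (leE (mulE (Add (Var 83) (Cst 1)) y) (Var 82)))).
Definition modE e y b := locked (Sub e (mulE (divE e y b) y)).
Definition addrE a e := locked (Add (Var 0) (Add (Cst a)
    (Bind 84 e (Add (Add (Var 84) (Var 84)) (Add (Var 84) (Var 84)))))).
Definition findE x y e := locked
  (Sum 85 y (notE (Sum x y (andE (leE (Var x) (Var 85)) e)))).
Definition argminE e := locked
  (findE 20 3 (Bind 27 e (notE (Sum 20 3 (ltE e (Var 27)))))).


Lemma sum_ltn m b : m <= b -> \sum_(i < b) (i < m) = m.
Proof.
elim: b => [|b IH] mb; first by rewrite big_ord0; lia.
rewrite big_ord_recr /=; case: (ltnP b m) => h.
  have -> : m = b.+1 by lia.
  rewrite (eq_bigr (fun=> 1)) ?sum1_card ?card_ord ?addn1 // => i _.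
  by rewrite ltnS ltnW.
by rewrite IH ?addn0; lia.
Qed.

Lemma sum_bool_neq0 m (f : 'I_m -> bool) :
  (\sum_(i < m) f i != 0) = [exists i, f i].
Proof.
rewrite sum_nat_bool -lt0n; apply/card_gt0P/existsP => -[i]; rewrite ?inE;
  by exists i; rewrite ?inE.
Qed.

Lemma bool_neq0 (b : bool) : ((b : nat) != 0) = b. Proof. by case: b. Qed.

(** * Values of the derived arithmetic and search expressions *)

Section Eval.
Variable G : geo -> rel nat.
Implicit Types (env mem : nat -> nat).
Local Notation ev := (eval G).

Lemma eval_Cst env mem c : ev env mem (Cst c) = c. Proof. by []. Qed.
Lemma eval_Var env mem x : ev env mem (Var x) = env x. Proof. by []. Qed.
Lemma eval_Add env mem e1 e2 :
  ev env mem (Add e1 e2) = ev env mem e1 + ev env mem e2.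
Proof. by []. Qed.
Lemma eval_Sub env mem e1 e2 :
  ev env mem (Sub e1 e2) = ev env mem e1 - ev env mem e2.
Proof. by []. Qed.
Lemma eval_Get env mem e : ev env mem (Get e) = mem (ev env mem e).
Proof. by []. Qed.
Lemma eval_Ite env mem e e1 e2 : ev env mem (Ite e e1 e2) =
  if ev env mem e != 0 then ev env mem e1 else ev env mem e2.
Proof. by []. Qed.
Lemma eval_Bind env mem x e1 e2 :
  ev env mem (Bind x e1 e2) = ev (upd env x (ev env mem e1)) mem e2.
Proof. by []. Qed.
Lemma eval_Sum env mem x y e :
  ev env mem (Sum x y e) = \sum_(i < env y) ev (upd env x i) mem e.
Proof. by []. Qed.
Lemma eval_Geo env mem g x y : ev env mem (Geo g x y) = G g (env x) (env y).
Proof. by []. Qed.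

Definition evE := (eval_Cst, eval_Var, eval_Add, eval_Sub, eval_Get, eval_Ite,
  eval_Bind, eval_Sum, eval_Geo).

Lemma eval_not env mem e : ev env mem (notE e) = (ev env mem e == 0).
Proof. by rewrite /notE -lock !evE; case: (ev env mem e). Qed.
Lemma eval_and env mem e1 e2 :
  ev env mem (andE e1 e2) = (ev env mem e1 != 0) && (ev env mem e2 != 0).
Proof.
by rewrite /andE -lock !evE; case: (ev env mem e1) (ev env mem e2) => [|?] [|?].
Qed.
Lemma eval_or env mem e1 e2 :
  ev env mem (orE e1 e2) = (ev env mem e1 != 0) || (ev env mem e2 != 0).
Proof.
by rewrite /orE -lock !evE; case: (ev env mem e1) (ev env mem e2) => [|?] [|?].
Qed.
Lemma eval_le env mem e1 e2 :
  ev env mem (leE e1 e2) = (ev env mem e1 <= ev env mem e2).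
Proof. by rewrite /leE -lock eval_not evE subn_eq0. Qed.
Lemma eval_lt env mem e1 e2 :
  ev env mem (ltE e1 e2) = (ev env mem e1 < ev env mem e2).
Proof. by rewrite /ltE -lock eval_le !evE addn1. Qed.
Lemma eval_eq env mem e1 e2 :
  ev env mem (eqE e1 e2) = (ev env mem e1 == ev env mem e2).
Proof. by rewrite /eqE -lock eval_and !eval_le !bool_neq0 eqn_leq. Qed.

Lemma upd_param env x v y : nparam <= x -> y < nparam -> upd env x v y = env y.
Proof. by move=> hx hy; rewrite /upd; case: eqP => // ?; lia. Qed.

Lemma eval_mul env mem e y : y < nparam ->
  ev env mem (mulE e y) = ev env mem e * env y.
Proof.
move=> hy; rewrite /mulE -lock !evE upd_param //.
under eq_bigr do rewrite evE.
by rewrite /upd /= sum_nat_const card_ord mulnC.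
Qed.

(** The quotient counts the positive multiples of the divisor up to the dividend; parameter [b] must
    be large enough to reach all of them. *)
Lemma eval_div env mem e y b : y < nparam -> b < nparam -> 0 < env y ->
  ev env mem e %/ env y <= env b ->
  ev env mem (divE e y b) = ev env mem e %/ env y.
Proof.
move=> hy hb y0 le_b; rewrite /divE -lock !evE upd_param // -[RHS](sum_ltn le_b).
apply: eq_bigr => i _; rewrite eval_le eval_mul // !evE ![upd _ _ _ y]upd_param //.
by rewrite /upd /= addn1 leq_divRL.
Qed.

Lemma eval_mod env mem e y b : y < nparam -> b < nparam -> 0 < env y ->
  ev env mem e %/ env y <= env b ->
  ev env mem (modE e y b) = ev env mem e %% env y.
Proof.
move=> *; rewrite /modE -lock eval_Sub eval_mul // eval_div //.
by rewrite {1}(divn_eq (ev _ _ _) (env y)) addKn.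
Qed.

Lemma eval_addr env mem a e :
  ev env mem (addrE a e) = env 0 + (a + 4 * ev env mem e).
Proof. by rewrite /addrE -lock !evE /upd /=; lia. Qed.

(** The first hit equals the number of [i] such that no hit is at most [i]. Without any hit this is
    the whole range, in agreement with [find]. *)
Lemma eval_find env mem x y e (p : nat -> bool) :
  nparam <= x -> x != 85 -> y < nparam ->
  (forall i u, u < env y -> (ev (upd (upd env 85 i) x u) mem e != 0) = p u) ->
  ev env mem (findE x y e) = find p (iota 0 (env y)).
Proof.
move=> hx nx hy H; rewrite /findE -lock eval_Sum.
have le : find p (iota 0 (env y)) <= env y.
  by rewrite -[X in _ <= X](size_iota 0) find_size.
rewrite -[RHS](sum_ltn le); apply: eq_bigr => i _; rewrite eval_not; congr nat_of_bool.
rewrite eval_Sum [upd _ _ _ y]upd_param //.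
rewrite (eq_bigr (fun u : 'I_(env y) => nat_of_bool ((u <= i) && p u))); last first.
  move=> u _; rewrite eval_and eval_le bool_neq0 !evE H //.
  by rewrite {1 2}/upd eqxx /upd eq_sym (negbTE nx) eqxx.
apply/idP/idP => [h|h].
  rewrite ltnNge; apply/negP => hi.
  have lt : find p (iota 0 (env y)) < env y by apply: leq_ltn_trans hi _.
  have hp : has p (iota 0 (env y)) by rewrite has_find size_iota.
  have := nth_find 0 hp; rewrite nth_iota // add0n => hp'.
  move: h; rewrite -[_ == 0]negbK sum_bool_neq0 => /existsP; apply.
  by exists (Ordinal lt); rewrite hi.
rewrite -[_ == 0]negbK sum_bool_neq0; apply/existsP => -[u /andP[ui pu]].
have := before_find 0 (leq_ltn_trans ui h).
by rewrite nth_iota // add0n pu.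
Qed.

(** The two hypotheses say that [e] is a function of variable 20 alone, unaffected by the search
    counter 85 and by variable 27, which stores the candidate value. *)
Lemma eval_argmin env mem e (f : nat -> nat) :
  (forall i u, u < env 3 -> ev (upd (upd env 85 i) 20 u) mem e = f u) ->
  (forall i u w v, u < env 3 -> v < env 3 ->
    ev (upd (upd (upd (upd env 85 i) 20 u) 27 w) 20 v) mem e = f v) ->
  ev env mem (argminE e) = argmin (env 3) f.
Proof.
move=> H1 H2; rewrite /argminE -lock (eval_find (p := fun u =>
  [forall v : 'I_(env 3), f u <= f v])) // => i u hu.
rewrite eval_Bind eval_not bool_neq0 eval_Sum !upd_param // H1 //.
under eq_bigr do rewrite eval_lt H2 // eval_Var {1}/upd /= {1}/upd /=.
rewrite -[_ == 0]negbK sum_bool_neq0 negb_exists; apply: eq_forallb => v.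
by rewrite -leqNgt.
Qed.

(** When entry [i] is computed, the earlier entries are correct and the rest of the memory is
    untouched; injectivity of [addr] protects the earlier entries from later writes. *)
Lemma tab_fill env x y ea e (mem : nat -> nat) (addr f : nat -> nat) :
  injective addr ->
  (forall i m, ev (upd env x i) m ea = addr i) ->
  (forall i m, i < env y -> (forall j, j < i -> m (addr j) = f j) ->
     (forall c, (forall j, j < i -> c <> addr j) -> m c = mem c) ->
     ev (upd env x i) m e = f i) ->
  let m := foldl (tab_step G env x ea e) mem (iota 0 (env y)) in
  (forall j, j < env y -> m (addr j) = f j) /\
  (forall c, (forall j, j < env y -> c <> addr j) -> m c = mem c).
Proof.
move=> inj Ha He /=; elim: (env y) He => [//|N IH] He.
have [i m iN|h1 h2] := IH; first by apply: He; apply: ltnW.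
rewrite -addn1 iotaD foldl_cat /= add0n.
set m := foldl _ _ _ in h1 h2 *.
rewrite /tab_step Ha He //; split=> [j jN|c hc].
  rewrite /upd; case: eqP => [/inj->//|ne]; apply: h1.
  move: ne jN; rewrite addn1 ltnS leq_eqVlt => ne /predU1P[E|//].
  by rewrite E in ne.
rewrite /upd; case: eqP => [E|_]; first by case: (hc N); rewrite ?addn1.
by apply: h2 => j jN; apply: hc; rewrite addn1 ltnW.
Qed.

End Eval.


(* Parameters: 0 is [n], 1 is [V = n.+1 ^ (256 * k)], 2 is [k], 3 is [Z = V * k],
   4 is [n.+1], and 5, 6, 7 are the sizes of the tables.  Four tables are
   interleaved in the integer memory from address [n] on. *)
Definition insX v i := locked
  (Get (addrE 0 (Add (mulE v 0) i))).
Definition lvlX j i := locked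
  (Get (addrE 1 (Add (mulE j 0) i))).
Definition distX t z := locked
  (Get (addrE 2 (Add (mulE t 3) z))).
Definition walkX a := locked
  (Get (addrE 3 a)).

Definition rowX := locked
  (Sum 11 0 (lvlX (Add (Var 11) (Cst 1)) (Var 10))).
Definition stripX := locked
  (divE (Add rowX (Var 12)) 2 4).
Definition lessX := locked
  (Bind 16 (Bind 10 (Var 14) stripX) (Bind 17 (Bind 10 (Var 15) stripX)
    (orE (ltE (Var 16) (Var 17)) (andE (eqE (Var 16) (Var 17))
      (orE (notE (Geo XLe 15 14))
           (andE (Geo XLe 14 15) (ltE (Var 14) (Var 15)))))))).
Definition rankX := locked
  (Sum 14 0 lessX).
Definition nthptX := locked
  (findE 15 0 (eqE rankX (Var 18))).
Definition setX x := locked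
  (divE (Var x) 2 1).
Definition shiftX x := locked
  (modE (Var x) 2 1).
Definition domX := locked
  (Bind 12 (shiftX 21) (Bind 25 nthptX (Bind 24 (setX 21)
    (Sum 26 0 (andE (insX (Var 24) (Var 26)) (Geo Near 26 25)))))).
Definition penaltyX e := locked
  (Ite e (Add (Var 0) (Add (Var 0) (Cst 1))) (Cst 0)).
Definition weightX := locked
  (Add (Bind 22 (setX 20) (Bind 24 (setX 21)
        (Sum 26 0 (andE (insX (Var 24) (Var 26))
                        (notE (insX (Var 22) (Var 26)))))))
      (Add (penaltyX (notE domX))
           (penaltyX (notE (eqE (shiftX 21) (shiftX 20)))))).
Definition extendX := locked
  (Add (distX (Var 18) (Var 20)) weightX).

Definition ins_entry := locked
  (Bind 21 (divE (Var 20) 0 1) (Bind 22 (Sub (Var 20) (mulE (Var 21) 0))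
    (Bind 23 (Sub (Var 21) (Cst 1)) (Bind 24 (divE (Var 23) 0 1)
      (andE (Var 21)
        (orE (eqE (Var 22) (Sub (Var 23) (mulE (Var 24) 0)))
             (insX (Var 24) (Var 22)))))))).
Definition lvl_entry := locked
  (Bind 21 (divE (Var 20) 0 4) (Bind 22 (Sub (Var 20) (mulE (Var 21) 0))
    (Ite (Var 21)
      (notE (notE (Sum 23 0 (andE (lvlX (Sub (Var 21) (Cst 1)) (Var 23))
                                  (Geo YGap 23 22)))))
      (Cst 1)))).
Definition dist_entry := locked
  (Bind 21 (modE (Var 28) 3 4) (Bind 18 (divE (Var 28) 3 4)
    (Ite (Var 18)
      (Bind 18 (Sub (Var 18) (Cst 1)) (Bind 20 (argminE extendX) extendX))
      (Bind 24 (setX 21) (Sum 26 0 (insX (Var 24) (Var 26))))))).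
Definition walk_entry := locked
  (Ite (Var 28)
    (Bind 18 (Sub (Var 0) (Var 28)) (Bind 21 (walkX (Sub (Var 28) (Cst 1)))
      (argminE extendX)))
    (argminE (distX (Var 0) (Var 20)))).
Definition out_entry := locked
  (Sum 26 4 (Bind 21 (walkX (Var 26)) (insX (setX 21) (Var 28)))).


Definition par n k V (env : nat -> nat) :=
  [/\ env 0 = n, env 1 = V, env 2 = k, env 3 = V * k & env 4 = n.+1].

Lemma par_upd n k V env x v :
  nparam <= x -> par n k V env -> par n k V (upd env x v).
Proof. by move=> hx [*]; split; rewrite upd_param. Qed.

Ltac params := repeat (apply: par_upd => //).

(** * Table entries agree with the shortest path specification *)

Section ProgramEval.
Variables (G : geo -> rel nat) (n k V : nat).
Hypothesis k_gt0 : 0 < k.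
Implicit Types (env mem : nat -> nat).
Local Notation ev := (eval G).
Local Notation Z := (V * k).
Local Notation par := (par n k V).

Definition okIns mem := forall v i, v < V -> i < n ->
  mem (n + (0 + 4 * (v * n + i))) = ins n v i.
Definition okLvl mem := forall j i, j < n.+1 -> i < n ->
  mem (n + (1 + 4 * (j * n + i))) = lvl G n j i.
Definition okDist t mem := forall z, z < Z ->
  mem (n + (2 + 4 * (t * Z + z))) = dist G n k Z t z.
Definition okWalk a mem := mem (n + (3 + 4 * a)) = walk G n k Z a.

(** No [okIns] is assumed, because this serves while that table is still being filled. *)
Lemma eval_insX env mem v i : ev env mem (insX v i) =
  mem (env 0 + (0 + 4 * (ev env mem v * env 0 + ev env mem i))).
Proof. by rewrite /insX -lock eval_Get eval_addr eval_Add eval_mul. Qed.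

Lemma eval_ins env mem v i : par env -> okIns mem ->
  ev env mem v < V -> ev env mem i < n ->
  ev env mem (insX v i) = ins n (ev env mem v) (ev env mem i).
Proof.
move=> [e0 *]; rewrite /insX -lock eval_Get eval_addr eval_Add eval_mul // e0.
by auto.
Qed.

Lemma eval_lvl env mem j i : par env -> okLvl mem ->
  ev env mem j < n.+1 -> ev env mem i < n ->
  ev env mem (lvlX j i) = lvl G n (ev env mem j) (ev env mem i).
Proof.
move=> [e0 *]; rewrite /lvlX -lock eval_Get eval_addr eval_Add eval_mul // e0.
by auto.
Qed.

Lemma eval_dist env mem t z : par env -> okDist (ev env mem t) mem ->
  ev env mem z < Z ->
  ev env mem (distX t z) = dist G n k Z (ev env mem t) (ev env mem z).
Proof.
move=> [e0 _ _ e3 _] *.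
rewrite /distX -lock eval_Get eval_addr eval_Add eval_mul // e0 e3.
by auto.
Qed.

Lemma eval_walk env mem a : par env -> okWalk (ev env mem a) mem ->
  ev env mem (walkX a) = walk G n k Z (ev env mem a).
Proof. by move=> [e0 *]; rewrite /walkX -lock eval_Get eval_addr e0. Qed.

Lemma eval_row env mem : par env -> okLvl mem -> env 10 < n ->
  ev env mem rowX = row G n (env 10).
Proof.
move=> pe ok h; rewrite /rowX -lock eval_Sum; have [e0 *] := pe; rewrite e0.
apply: eq_bigr => i _; rewrite eval_lvl ?evE //; first by rewrite /upd /= addn1.
- by rewrite /upd /= addn1 ltnS.
Qed.

Lemma eval_strip env mem : par env -> okLvl mem -> env 10 < n -> env 12 < k ->
  ev env mem stripX = strip G n k (env 12) (env 10).
Proof.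
move=> pe ok h hr; have [e0 e1 e2 e3 e4] := pe.
have rn : row G n (env 10) <= n.
  rewrite /row -[X in _ <= X]card_ord -sum1_card; apply: leq_sum => j _.
  by case: (lvl _ _ _ _).
rewrite /stripX -lock eval_div ?eval_Add ?eval_row ?eval_Var ?e2 ?e4 //.
(* This bounds the quotient by parameter 4, the search range of the division. *)
have h1 : row G n (env 10) + env 12 <= n.+1 * k by nia.
by apply: leq_trans (leq_div2r k h1) _; rewrite mulnK.
Qed.

Lemma eval_less env mem : par env -> okLvl mem -> env 14 < n -> env 15 < n ->
  env 12 < k -> ev env mem lessX = less G n k (env 12) (env 14) (env 15).
Proof.
move=> pe ok h1 h2 hr; rewrite /lessX -lock /= !eval_strip //.
rewrite eval_or eval_and eval_or eval_and eval_not !eval_lt eval_eq /=.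
by rewrite !bool_neq0 /upd /= eqb0.
Qed.

Lemma eval_rank env mem : par env -> okLvl mem -> env 15 < n ->
  env 12 < k -> ev env mem rankX = rank G n k (env 12) (env 15).
Proof.
move=> pe ok h2 hr; rewrite /rankX -lock eval_Sum; have [e0 *] := pe; rewrite e0.
by apply: eq_bigr => i _; rewrite eval_less //; apply: ltn_ord.
Qed.

Lemma eval_nthpt env mem : par env -> okLvl mem -> env 12 < k ->
  ev env mem nthptX = nthpt G n k (env 12) (env 18).
Proof.
move=> pe ok hr; have [e0 *] := pe; rewrite /nthptX -lock.
rewrite (@eval_find _ _ _ _ _ _ (fun p => rank G n k (env 12) p == env 18)) //.
  by rewrite e0.
move=> i u; rewrite e0 => hu; rewrite eval_eq bool_neq0 eval_rank //.
Qed.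

Lemma eval_set env mem x : par env -> env x < Z ->
  ev env mem (setX x) = env x %/ k.
Proof.
move=> [e0 e1 e2 *]; rewrite /setX -lock eval_div /= ?e1 ?e2 //.
by apply: ltnW; rewrite ltn_divLR.
Qed.

Lemma eval_shift env mem x : par env -> env x < Z ->
  ev env mem (shiftX x) = env x %% k.
Proof.
move=> [e0 e1 e2 *]; rewrite /shiftX -lock eval_mod /= ?e1 ?e2 //.
by apply: ltnW; rewrite ltn_divLR.
Qed.

Lemma set_lt z : z < Z -> z %/ k < V.
Proof. by move=> h; rewrite ltn_divLR. Qed.

Lemma eval_dom env mem : par env -> okIns mem -> okLvl mem -> env 21 < Z ->
  (ev env mem domX != 0) = dom G n k (env 18) (env 21).
Proof.
move=> pe okI okL hz; have [e0 *] := pe.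
have hm : env 21 %% k < k by rewrite ltn_pmod.
rewrite /domX -lock !eval_Bind eval_shift // eval_nthpt //.
rewrite eval_set //.
rewrite eval_Sum [upd _ _ _ 0]upd_param // [upd _ _ _ 0]upd_param //.
rewrite [upd _ _ _ 0]upd_param // e0 /dom -sum_bool_neq0.
congr (_ != 0); apply: eq_bigr => i _.
rewrite eval_and eval_ins ?evE ?bool_neq0 //.
all: by [exact: set_lt|exact: ltn_ord].
Qed.

Lemma eval_penalty env mem e (b : bool) : par env ->
  (ev env mem e != 0) = b -> ev env mem (penaltyX e) = penalty n b.
Proof.
move=> [e0 *]; rewrite /penaltyX -lock !evE e0 /penalty.
by case: ifP; case: ifP; congruence.
Qed.

Lemma eval_weight env mem : par env -> okIns mem -> okLvl mem ->
  env 20 < Z -> env 21 < Z ->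
  ev env mem weightX = weight G n k (env 18) (env 20) (env 21).
Proof.
move=> pe okI okL hu hz; have [e0 *] := pe.
rewrite /weightX -lock !eval_Add.
rewrite (@eval_penalty _ _ _ (~~ dom G n k (env 18) (env 21))) //; last first.
  by rewrite eval_not bool_neq0 -(@eval_dom env mem) // negbK.
rewrite (@eval_penalty _ _ _ (env 21 %% k != env 20 %% k)) //; last first.
  by rewrite eval_not bool_neq0 eval_eq eqb0 !eval_shift.
congr (_ + _); rewrite !eval_Bind !eval_set //.
rewrite eval_Sum ![upd _ _ _ 0]upd_param // e0.
apply: eq_bigr => i _; rewrite eval_and eval_not !eval_ins ?evE ?bool_neq0 ?eqb0 //.
all: by [exact: set_lt|exact: ltn_ord].
Qed.

Lemma eval_extend env mem : par env -> okIns mem -> okLvl mem ->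
  okDist (env 18) mem -> env 20 < Z -> env 21 < Z ->
  ev env mem extendX =
    dist G n k Z (env 18) (env 20) + weight G n k (env 18) (env 20) (env 21).
Proof.
by move=> *; rewrite /extendX -lock eval_Add eval_dist ?eval_weight ?evE.
Qed.

Lemma eval_argmin_extend env mem : par env -> okIns mem -> okLvl mem ->
  okDist (env 18) mem -> env 21 < Z ->
  ev env mem (argminE extendX) = argmin Z
    (fun u => dist G n k Z (env 18) u + weight G n k (env 18) u (env 21)).
Proof.
move=> pe okI okL okD hz; have [_ _ _ e3 _] := pe.
rewrite (@eval_argmin _ _ _ _ (fun u => dist G n k Z (env 18) u +
  weight G n k (env 18) u (env 21))) e3 // => i u *.
  by rewrite eval_extend.
by rewrite eval_extend.
Qed.

(** For a nonempty code [v], the entry reads the one for [(v - 1) %/ n], a smaller code and hence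
    already present. For [v = 0] the conjunction discards whatever is read. *)
Lemma eval_ins_entry env mem a : par env -> a < V * n ->
  (forall b, b < a -> mem (n + (0 + 4 * b)) = ins n (b %/ n) (b %% n)) ->
  ev (upd env 20 a) mem ins_entry = ins n (a %/ n) (a %% n).
Proof.
move=> pe ha ok; have n0 : 0 < n by lia.
have [e0 e1 _ _ _] := pe.
have qV : a %/ n < V by rewrite ltn_divLR.
rewrite /ins_entry -lock /= eval_div; [|by []|by []|by rewrite /upd /= e0|]; last first.
  by rewrite /upd /= e0 e1 ltnW.
rewrite eval_mul //=.
set env3 := upd (upd (upd (upd env 20 a) 21 _) 22 _) 23 _.
have pe3 : par env3 by params.
have v21 : env3 21 = a %/ n by rewrite /env3 /upd /= e0.
have v22 : env3 22 = a %% n.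
  by rewrite /env3 /upd /= e0 {1}(divn_eq a n) addKn.
have v23 : env3 23 = (a %/ n).-1 by rewrite /env3 /upd /= e0 subn1.
move: env3 pe3 v21 v22 v23 => env3 pe3 v21 v22 v23.
have [f0 f1 _ _ _] := pe3.
have q1 : (a %/ n).-1 %/ n <= a %/ n.
  by rewrite (leq_trans (leq_div _ _)) // leq_pred.
rewrite eval_div; [|by []|by []|by rewrite f0|]; last first.
  by rewrite /= f0 f1 v23; apply: leq_trans q1 (ltnW qV).
rewrite eval_and eval_or eval_eq /= eval_mul // eval_insX /= !bool_neq0.
rewrite /upd /= f0 v21 v22 v23.
case E: (a %/ n) => [|u] //=.
have mE : u - u %/ n * n = u %% n by rewrite {1}(divn_eq u n) addKn.
have un : u %/ n <= u by apply: leq_div.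
rewrite insS mE ok; last by rewrite [X in _ < X](divn_eq a n) E ltn_add2r ltn_pmul2r.
by rewrite modnMDl divnMDl // modn_mod (divn_small (ltn_pmod a n0)) addn0 bool_neq0.
Qed.

Lemma eval_lvl_entry env mem a : par env -> a < n.+1 * n ->
  (forall b, b < a -> mem (n + (1 + 4 * b)) = lvl G n (b %/ n) (b %% n)) ->
  ev (upd env 20 a) mem lvl_entry = lvl G n (a %/ n) (a %% n).
Proof.
move=> pe ha ok; have n0 : 0 < n by lia.
have [e0 _ _ _ e4] := pe.
have qV : a %/ n < n.+1 by rewrite ltn_divLR.
rewrite /lvl_entry -lock /= eval_div; [|by []|by []|by rewrite /upd /= e0|]; last first.
  by rewrite /upd /= e0 e4 ltnW.
rewrite eval_mul //=.
set env2 := upd (upd (upd env 20 a) 21 _) 22 _.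
have pe2 : par env2 by params.
have v21 : env2 21 = a %/ n by rewrite /env2 /upd /= e0.
have v22 : env2 22 = a %% n.
  by rewrite /env2 /upd /= e0 {1}(divn_eq a n) addKn.
move: env2 pe2 v21 v22 => env2 pe2 v21 v22.
have [f0 _ _ _ _] := pe2.
rewrite v21; case E: (a %/ n) => [|j] //=.
rewrite !eval_not /= f0.
rewrite (eq_bigr (fun q : 'I_n => nat_of_bool (lvl G n j q && G YGap q (a %% n)))).
  by rewrite eqb0 sum_bool_neq0.
move=> q _; rewrite eval_and /lvlX -lock eval_Get eval_addr eval_Add eval_mul //=.
rewrite /upd /= f0 v21 v22 E subn1 /= ok ?bool_neq0.
  by rewrite divnMDl // modnMDl modn_small // divn_small // addn0.
by have := divn_eq a n; have := ltn_ord q; rewrite E; nia.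
Qed.

Lemma eval_dist_entry env mem a : par env -> okIns mem -> okLvl mem ->
  a < n.+1 * Z ->
  (forall b, b < a -> mem (n + (2 + 4 * b)) = dist G n k Z (b %/ Z) (b %% Z)) ->
  ev (upd env 28 a) mem dist_entry = dist G n k Z (a %/ Z) (a %% Z).
Proof.
move=> pe okI okL ha ok; have Z0 : 0 < Z by lia.
have [e0 _ _ e3 e4] := pe.
have qn : a %/ Z < n.+1 by rewrite ltn_divLR.
rewrite /dist_entry -lock /=.
rewrite eval_mod; [|by []|by []|by rewrite /upd /= e3|]; last first.
  by rewrite /upd /= e3 e4 ltnW.
rewrite eval_div; [|by []|by []|by rewrite /upd /= e3|]; last first.
  by rewrite /upd /= e3 e4 ltnW.
rewrite /=.
set env2 := upd (upd (upd env 28 a) 21 _) 18 _.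
have pe2 : par env2 by params.
have v18 : env2 18 = a %/ Z by rewrite /env2 /upd /= e3.
have v21 : env2 21 = a %% Z by rewrite /env2 /upd /= e3.
move: env2 pe2 v18 v21 => env2 pe2 v18 v21.
have [f0 _ _ _ _] := pe2.
have az : a %% Z < Z by rewrite ltn_pmod.
rewrite v18; case E: (a %/ Z) => [|t] //=.
  rewrite eval_set ?v21 // [upd _ _ _ 0]upd_param // f0.
  apply: eq_bigr => i _; rewrite eval_ins //=; [exact: set_lt|exact: ltn_ord].
rewrite subn1 /=.
have pe3 : par (upd env2 18 t) by apply: par_upd.
(* Layers are stored consecutively, so the whole layer [t] precedes any entry of layer [t.+1]. *)
have okD : okDist t mem.
  move=> z hz; rewrite ok ?divnMDl ?modnMDl ?(modn_small hz) ?(divn_small hz) ?addn0 //.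
  by rewrite [X in _ < X](divn_eq a Z) E; nia.
have Eu : ev (upd env2 18 t) mem (argminE extendX) =
    argmin Z (fun u => dist G n k Z t u + weight G n k t u (a %% Z)).
  by rewrite eval_argmin_extend // /upd /= ?v21.
have [lt_u _] := argminP
  (fun u => dist G n k Z t u + weight G n k t u (a %% Z)) Z0.
rewrite Eu eval_extend //; rewrite /upd /= ?v21 //.
Qed.

Lemma eval_walk_entry env mem a : par env -> okIns mem -> okLvl mem ->
  (forall t, t <= n -> okDist t mem) -> 0 < Z -> a <= n ->
  (forall b, b < a -> okWalk b mem) ->
  ev (upd env 28 a) mem walk_entry = walk G n k Z a.
Proof.
move=> pe okI okL okD Z0 ha ok; rewrite /walk_entry -lock /=.
have pe1 : par (upd env 28 a) by params.
have v28 : upd env 28 a 28 = a by [].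
move: (upd env 28 a) pe1 v28 => {pe} env1 pe v28; have [e0 e1 e2 e3 e4] := pe.
rewrite v28; case: a ha ok v28 => [|a] ha ok v28 /=.
  rewrite (@eval_argmin _ _ _ _ (dist G n k Z n)) ?e3 // => i u *.
    by rewrite eval_dist //= /upd /= e0 //; apply: okD.
  by rewrite eval_dist //= /upd /= e0 //; apply: okD.
have ok1 : okWalk a mem by apply: ok.
rewrite eval_walk /=; last 2 first.
- by params.
- by rewrite /upd /= v28 subn1.
rewrite eval_argmin_extend /upd /= ?e0 ?v28 ?subn1 //.
- by apply: okD; apply: leq_subr.
- exact: walk_lt.
Qed.

Lemma eval_out_entry env mem i : par env -> okIns mem ->
  (forall a, a <= n -> okWalk a mem) -> 0 < Z -> i < n ->
  ev (upd env 28 i) mem out_entry = \sum_(a < n.+1) ins n (walk G n k Z a %/ k) i.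
Proof.
move=> pe okI okW Z0 hi; have [e0 e1 e2 e3 e4] := pe.
rewrite /out_entry -lock eval_Sum [upd _ _ _ 4]upd_param // e4.
apply: eq_bigr => a _.
have okWa : okWalk a mem by apply: okW; rewrite -ltnS.
have lt_w := walk_lt G n k a Z0.
rewrite /= eval_walk //= eval_ins ?eval_set //=.
exact: set_lt.
Qed.

End ProgramEval.

(** * The complete program and its semantics *)

Definition power_step := Assign 1 (Add (Var 1) (mulE (Var 1) 0)).

Definition sizes : seq stmt :=
  [:: Assign 3 (mulE (Var 1) 2); Assign 4 (Add (Var 0) (Cst 1));
      Assign 5 (mulE (Var 4) 3); Assign 6 (mulE (Var 4) 0);
      Assign 7 (mulE (Var 1) 0)].

Definition fills : seq stmt :=
  [:: Tab 20 7 (addrE 0 (Var 20)) ins_entry;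
      Tab 20 6 (addrE 1 (Var 20)) lvl_entry;
      Tab 28 5 (addrE 2 (Var 28)) dist_entry;
      Tab 28 4 (addrE 3 (Var 28)) walk_entry;
      Tab 28 0 (Var 28) out_entry].

(** [k] occurs only as a literal and as a repetition count, so the heights of the statements do not
    depend on it. *)
Definition algorithm k : seq stmt :=
  [:: Assign 1 (Cst 1); Assign 2 (Cst k)] ++
  nseq (256 * k) power_step ++ sizes ++ fills.

Lemma wf_algorithm k : all wf_stmt (algorithm k).
Proof.
rewrite /algorithm !all_cat all_nseq; apply/and4P; split=> //.
(* Destructing [master_key] opens the locks, after which well-formedness is a computation. *)
- by rewrite orbC /power_step /mulE /locked; case: master_key.
- by rewrite /sizes /mulE /locked; case: master_key.
rewrite /fills /ins_entry /lvl_entry /dist_entry /walk_entry /out_entry /extendX.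
rewrite /weightX /domX /penaltyX /shiftX /setX /nthptX /rankX /lessX /stripX /rowX.
rewrite /walkX /distX /lvlX /insX /argminE /findE /addrE /modE /divE /mulE /eqE.
by rewrite /ltE /leE /orE /andE /notE /locked; case: master_key.
Qed.

Section Frame.
Variables (G : geo -> rel nat) (n k V a : nat) (m m' : nat -> nat).
Hypothesis frame : forall c, (forall j, c <> n + (a + 4 * j)) -> m c = m' c.

(** The tables occupy different residues modulo 4 relative to [n], so filling one preserves the
    others. *)
Lemma okIns_frame : 0 < a < 4 -> okIns n V m' -> okIns n V m.
Proof. by move=> ha H v i hv hi; rewrite frame ?H // => j; lia. Qed.

Lemma okLvl_frame : a != 1 -> a < 4 -> okLvl G n m' -> okLvl G n m.
Proof. by move=> ha ha' H j i hj hi; rewrite frame ?H // => j'; lia. Qed.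

Lemma okDist_frame t : a != 2 -> a < 4 -> okDist G n k V t m' -> okDist G n k V t m.
Proof. by move=> ha ha' H z hz; rewrite frame ?H // => j; lia. Qed.
End Frame.

Section Semantics.
Variables (G : geo -> rel nat) (n k V : nat).
Hypotheses (k_gt0 : 0 < k) (V_gt0 : 0 < V).
Local Notation Z := (V * k).

Lemma params_le_set B env x v :
  v <= B -> params_le B env -> params_le B (upd env x v).
Proof. by move=> vB H y hy; rewrite /upd; case: eqP => // _; apply: H. Qed.

Lemma power_sem m (env mem : nat -> nat) :
  sems G (nseq m power_step) (env, mem) =
  (upd env 1 (env 1 * (env 0).+1 ^ m), mem).
Proof.
elim: m env => [|m IH] env; first by rewrite muln1 upd_same.
rewrite /sems /= -/(sems _ _ _) IH upd_id eval_mul //= expnS mulnA.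
by congr (upd _ _ _, _); rewrite /upd /= mulnS.
Qed.

Lemma power_safe B m (env mem : nat -> nat) : params_le B env ->
  env 1 * (env 0).+1 ^ m <= B -> safe G B (nseq m power_step) (env, mem).
Proof.
elim: m env => [|m IH] env //= pB; rewrite eval_mul //= => le_B; split=> //.
have e : upd env 1 (env 1 + env 1 * env 0) 1 = env 1 * (env 0).+1.
  by rewrite /upd /= mulnS.
apply: IH; last by rewrite e /upd /= -mulnA -expnS.
apply: params_le_set pB; rewrite -mulnS; apply: leq_trans le_B.
by rewrite leq_mul2l expnS leq_pmulr ?orbT // expn_gt0.
Qed.

Definition size_env env :=
  upd (upd (upd (upd (upd env 3 Z) 4 n.+1) 5 (n.+1 * Z)) 6 (n.+1 * n)) 7 (V * n).

Lemma sizes_sem env mem : env 0 = n -> env 1 = V -> env 2 = k ->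
  sems G sizes (env, mem) = (size_env env, mem).
Proof.
move=> e0 e1 e2; rewrite /sems /= !eval_mul //= /size_env.
by congr pair; rewrite ![upd _ _ _ _]/upd /= !addn1 ?e0 ?e1 ?e2.
Qed.

Lemma fill_array a x y e env mem (f : nat -> nat) : nparam <= x -> env 0 = n ->
  (forall i m, i < env y -> (forall j, j < i -> m (n + (a + 4 * j)) = f j) ->
    (forall c, (forall j, c <> n + (a + 4 * j)) -> m c = mem c) ->
    eval G (upd env x i) m e = f i) ->
  exists m, [/\ sem G (Tab x y (addrE a (Var x)) e) (env, mem) =
                (upd env x (env y), m),
    forall j, j < env y -> m (n + (a + 4 * j)) = f j &
    forall c, (forall j, c <> n + (a + 4 * j)) -> m c = mem c].
Proof.
move=> hx e0 H.
have [|i m|i m hi h1 h2|h1 h2] := @tab_fill G env x y (addrE a (Var x)) e mem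
  (fun j => n + (a + 4 * j)) f.
- by move=> i j; lia.
- by rewrite eval_addr /= upd_param // e0 /upd eqxx.
- by apply: H => // c hc; apply: h2 => j _; apply: hc.
by eexists; split=> [||c hc]; [by []|exact: h1|apply: h2 => j _; apply: hc].
Qed.

(** The output is written below address [n], where no table lies, and cell [i] receives the number
    of layers of the walk containing [i]. *)
Lemma fills_sem env mem i : par n k V env -> env 5 = n.+1 * Z ->
  env 6 = n.+1 * n -> env 7 = V * n -> i < n ->
  ((sems G fills (env, mem)).2 i != 0) = selected G n k Z i.
Proof.
move=> pe e5 e6 e7 hi; have Z0 : 0 < Z by rewrite muln_gt0 V_gt0.
have n0 : 0 < n by lia.
rewrite /fills /sems [foldl _ _ _]/foldl.
have [e0 _ _ _ e4] := pe.
have [|m1 [-> f1 _]] := @fill_array 0 20 7 ins_entry env mem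
  (fun a => ins n (a %/ n) (a %% n)) isT e0.
  by move=> a m; rewrite e7 => ha H _; apply: (@eval_ins_entry _ _ k V).
have okI1 : okIns n V m1.
  move=> v j hv hj; rewrite f1 ?e7; last by nia.
  by rewrite divnMDl // modnMDl modn_small // divn_small // addn0.
have pe1 : par n k V (upd env 20 (env 7)) by params.
have [|m2 [-> f2 g2]] := @fill_array 1 20 6 lvl_entry (upd env 20 (env 7)) m1
  (fun a => lvl G n (a %/ n) (a %% n)) isT e0.
  by move=> a m; rewrite upd_param // e6 => ha H _; apply: (@eval_lvl_entry _ _ k V).
rewrite upd_param // e6 in f2 *.
have okL2 : okLvl G n m2.
  move=> j q hj hq; rewrite f2; last by nia.
  by rewrite divnMDl // modnMDl modn_small // divn_small // addn0.
have okI2 := okIns_frame g2 isT okI1.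
set env2 := upd _ 20 _.
have pe2 : par n k V env2 by params.
have e52 : env2 5 = n.+1 * Z by rewrite -e5.
have [|m3 [-> f3 g3]] := @fill_array 2 28 5 dist_entry env2 m2
  (fun a => dist G n k Z (a %/ Z) (a %% Z)) isT e0.
  move=> a m; rewrite e52 => ha H g; apply: (@eval_dist_entry _ _ k V) => //.
    exact: okIns_frame g _ okI2.
  exact: okLvl_frame g _ _ okL2.
rewrite e52 in f3 *.
have okD3 t : t <= n -> okDist G n k V t m3.
  move=> tn z hz; rewrite f3; last by nia.
  by rewrite divnMDl // modnMDl modn_small // divn_small // addn0.
have okI3 := okIns_frame g3 isT okI2.
have okL3 := okLvl_frame g3 isT isT okL2.
set env3 := upd _ 28 _.
have pe3 : par n k V env3 by params.
have e43 : env3 4 = n.+1 by rewrite -e4.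
have [|m4 [-> f4 g4]] := @fill_array 3 28 4 walk_entry env3 m3
  (fun a => walk G n k Z a) isT e0.
  move=> a m; rewrite e43 => ha H g.
  apply: (@eval_walk_entry _ _ k V) => //.
  - exact: okIns_frame g _ okI3.
  - exact: okLvl_frame g _ _ okL3.
  - by move=> t tn; apply: (okDist_frame g) => //; apply: okD3.
rewrite e43 in f4 *.
have okI4 := okIns_frame g4 isT okI3.
set env4 := upd _ 28 _.
have pe4 : par n k V env4 by params.
pose val_out j := \sum_(a < n.+1) ins n (walk G n k Z a %/ k) j.
have ent j m : j < env4 0 -> (forall l, l < j -> m l = val_out l) ->
    (forall c, (forall l, l < j -> c <> l) -> m c = m4 c) ->
    eval G (upd env4 28 j) m out_entry = val_out j.
  move=> hj _ g; have e40 : env4 0 = n by [].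
  rewrite e40 in hj; apply: (@eval_out_entry _ _ k V) => //.
    by move=> v q hv hq; rewrite g ?okI4 // => l hl; lia.
  by move=> a ha; rewrite /okWalk g ?f4 // => l hl; lia.
have [h _] := @tab_fill G env4 28 0 (Var 28) out_entry m4 id _
  (fun _ _ e => e) (fun _ _ => erefl) ent.
have hi4 : i < env4 0 by have -> : env4 0 = n by [].
have := h i hi4.
by rewrite /sem /snd => ->; rewrite sum_bool_neq0.
Qed.

Lemma fills_safe B env mem : params_le B env -> safe G B fills (env, mem).
Proof. by move=> pB /=; repeat (split; first by do ?apply: params_le_upd). Qed.

Lemma sizes_safe B env mem : env 0 = n -> env 1 = V -> env 2 = k ->
  params_le B env -> Z <= B -> n.+1 <= B -> n.+1 * Z <= B -> n.+1 * n <= B ->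
  safe G B sizes (env, mem).
Proof.
move=> e0 e1 e2 pB *; rewrite /= !eval_mul //=.
rewrite ![upd _ _ _ _]/upd /= ?addn1 ?e0 ?e1 ?e2.
by repeat (split; first by do ?apply: params_le_set).
Qed.
End Semantics.

(** * Running time and conclusion *)

(** A sum dominates every height without computing a maximum; the 3 covers the two constant
    assignments that open the program. *)
Definition height_bound : nat :=
  sumn [seq stmt_height c | c <- power_step :: sizes ++ fills] + 3.

Lemma all_leq_sumn (l : seq nat) : all (leq^~ (sumn l)) l.
Proof.
elim: l => //= a l IH; rewrite leq_addr /=.
by apply: sub_all IH => b /leq_trans; apply; apply: leq_addl.
Qed.

Lemma algorithm_height k : all (fun c => stmt_height c <= height_bound) (algorithm k).
Proof.
have: all (fun c => stmt_height c <= height_bound) (power_step :: sizes ++ fills).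
  rewrite -(all_map stmt_height (leq^~ height_bound)).
  apply: sub_all (all_leq_sumn _) => b /leq_trans; apply.
  by rewrite /height_bound leq_addr.
rewrite -cat1s all_cat all_seq1 => /andP[h1 h2].
rewrite /algorithm all_cat all_cat all_nseq h1 h2 orbT !andbT.
have h3 a : a <= 3 -> a <= height_bound by move/leq_trans; apply; apply: leq_addl.
by rewrite /= !h3.
Qed.

Lemma sum_cost_le B h l : all (fun c => stmt_height c <= h) l ->
  \sum_(c <- l) stmt_cost B c <= size l * (B + 20) ^ h.
Proof.
elim: l => [|c l IH] /=; first by rewrite big_nil.
case/andP => hc /IH h2; rewrite big_cons mulSn leq_add //.
by apply: leq_trans (stmt_cost_height B c) _; rewrite leq_pexp2l // addnS.
Qed.

Definition param_bound n k := n.+1 ^ (256 * k + 2) * k.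

(** With [n.+1 <= N ^ 2] and [k <= N ^ k], the parameters are at most [N ^ (513 * k + 4)]; a factor
    [N ^ 5 >= 32] absorbs the offset 20, and [k >= 1] turns the exponent into [522 * k]. The number
    of statements is at most [N ^ (10 * k)]. The base is at least 2, since powers of 0 or 1 bound
    nothing. *)
Lemma time_bound n k t : 0 < k ->
  t <= \sum_(c <- algorithm k) stmt_cost (param_bound n k) c + 1 ->
  t <= maxn 2 n ^ ((522 * height_bound + 10) * k).
Proof.
move=> k0 ht; set N := maxn 2 n; apply: leq_trans ht _.
have N2 : 2 <= N by apply: leq_maxl.
have pw a b : a <= b -> N ^ a <= N ^ b by move=> ab; rewrite leq_pexp2l //; lia.
have exp2 a : a <= N ^ a by apply: ltnW; apply: ltn_expl.
have n1 : n.+1 <= N ^ 2.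
  rewrite -mulnn; have : n <= N by apply: leq_maxr.
  nia.
have hB : param_bound n k + 20 <= N ^ (522 * k).
  have h1 : param_bound n k <= N ^ (513 * k + 4).
    rewrite (_ : 513 * k + 4 = 2 * (256 * k + 2) + k); last by lia.
    rewrite expnD leq_mul // expnM leq_exp2r //; lia.
  have h2 : N ^ (513 * k + 4) * N ^ 5 <= N ^ (522 * k).
    by rewrite -expnD; apply: pw; lia.
  apply: leq_trans h2;
  have h3 : 32 <= N ^ 5 by apply: (@leq_trans (2 ^ 5)); rewrite ?leq_exp2r.
  have h4 : 1 <= N ^ (513 * k + 4) by rewrite expn_gt0; lia.
  nia.
have hs : size (algorithm k) + 1 <= N ^ (10 * k).
  have -> : size (algorithm k) + 1 = 256 * k + 13.
    by rewrite !size_cat size_nseq /=; lia.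
  have h1 : N ^ 9 * N ^ k <= N ^ (10 * k) by rewrite -expnD; apply: pw; lia.
  apply: leq_trans h1;
  have h3 : 512 <= N ^ 9 by apply: (@leq_trans (2 ^ 9)); rewrite ?leq_exp2r.
  have := exp2 k; nia.
rewrite mulnDl expnD.
apply: (@leq_trans ((size (algorithm k) + 1) * (param_bound n k + 20) ^ height_bound)).
  rewrite mulnDl mul1n leq_add ?sum_cost_le ?algorithm_height // expn_gt0; lia.
rewrite mulnC leq_mul //.
rewrite (_ : 522 * height_bound * k = 522 * k * height_bound); last by lia.
by rewrite expnM; case: height_bound => // h; rewrite leq_exp2r.
Qed.

Section Run.
Variables (R : realType) (s : seq (R * R)) (k : nat).
Hypothesis k_gt0 : 0 < k.
Local Notation n := (size s).
Local Notation G := (pt_rel s).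

Lemma algorithm_runs : exists t (st : state R),
  [/\ exec (cprog (algorithm k)) (input_state s) t st,
      t <= maxn 2 n ^ ((522 * height_bound + 10) * k) &
      forall i, i < n ->
        (imem st i != 0) = selected G n k (n.+1 ^ (256 * k) * k) i].
Proof.
set V := n.+1 ^ (256 * k); set B := param_bound n k.
have V0 : 0 < V by rewrite expn_gt0.
have BE : B = V * n.+1 ^ 2 * k by rewrite /B /param_bound expnD.
have n1 : n.+1 <= n.+1 ^ 2 by rewrite -mulnn leq_pmulr.
have le1 : n.+1 * V * k <= B by rewrite BE leq_mul2r mulnC leq_mul2l n1 !orbT.
have le2 : n.+1 * n <= B.
  rewrite BE; apply: (@leq_trans (n.+1 ^ 2)).
    by rewrite -mulnn leq_mul2l ltnW ?orbT.
  by rewrite -mulnA mulnCA leq_pmulr // muln_gt0 V0.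
have nV : V * k <= n.+1 * V * k by rewrite -mulnA leq_pmull.
set env0 := env_of (input_state s).
have env0E x : env0 x = if x == 0 then n else 0 by case: x.
have pB0 : params_le B env0.
  by move=> y _; rewrite env0E; case: ifP => // _; nia.
have kB : k <= B by nia.
have VB : V <= B by nia.
set env1 := upd (upd env0 1 1) 2 k.
set env2 := upd env1 1 V.
have pB1 : params_le B env1.
  by apply: params_le_set => //; apply: params_le_set => //; nia.
have E2 : sems G (nseq (256 * k) power_step) (env1, imem (input_state s)) =
          (env2, imem (input_state s)).
  by rewrite power_sem /env1 /upd /= mul1n.
have E3 : sems G sizes (env2, imem (input_state s)) =
    (size_env n k V env2, imem (input_state s)).
  by apply: sizes_sem.
have hsafe : safe G B (algorithm k) (env0, imem (input_state s)).
  apply: safe_cat.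
    by rewrite /=; split=> //; split=> //; apply: params_le_set => //; nia.
  rewrite [sems _ _ _]/= -/env1; apply: safe_cat.
    by apply: power_safe => //; rewrite /env1 /upd /= mul1n.
  rewrite E2; apply: safe_cat.
    apply: (@sizes_safe _ n k V) => //; rewrite ?mulnA //; try nia.
    exact: params_le_set.
  rewrite E3; apply: fills_safe; rewrite /size_env.
  by do 5!(apply: params_le_set; first by nia); apply: params_le_set.
have [t [st [ex ht E]]] := cprogP (wf_algorithm k) (erefl (rmem (input_state s))) hsafe.
exists t, st; split=> //; first exact: time_bound.
move=> i hi; have -> : imem st = (sems G fills
    (size_env n k V env2, imem (input_state s))).2.
  rewrite (_ : imem st = (env_of st, imem st).2) // E /algorithm !sems_cat.
  by rewrite [sems _ [:: _; _] _]/= -/env1 E2 E3.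
by apply: (@fills_sem _ _ _ V).
Qed.
End Run.

(** * From finite sets of points to sets of indices *)

Section Sets.
Local Open Scope fset_scope.
Variables (R : realType) (s : seq (R * R)) (S : {fset R * R}).
Hypotheses (s_uniq : uniq s) (sS : s =i S).
Local Notation n := (size s).
Local Notation point i := (nth (0, 0)%R s i).

Definition indices (D : {fset R * R}) : {set 'I_n} := [set i : 'I_n | point i \in D].

Lemma edist_near i j : (edist (point i) (point j) <= 1)%R = pt_rel s Near i j.
Proof.
by rewrite /edist -[X in (_ <= X)%R]sqrtr1 ler_sqrt ?ltr01.
Qed.

Lemma edist_sym (p q : R * R) : edist p q = edist q p.
Proof.
by rewrite /edist -[((p.1 - _) ^+ 2)%R]sqrrN -[((p.2 - _) ^+ 2)%R]sqrrN !opprB.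
Qed.

Lemma point_index p : p \in s -> exists i : 'I_n, point i = p.
Proof.
by move=> ps; exists (Ordinal (etrans (index_mem p s) ps)); rewrite nth_index.
Qed.

Lemma card_indices D : {subset D <= s} -> #|indices D| = #|` D|.
Proof.
move=> Ds; rewrite cardE -(size_map (fun i : 'I_n => point i)).
apply/perm_size/uniq_perm; rewrite ?fset_uniq //.
  rewrite map_inj_in_uniq ?enum_uniq // => i j _ _ /eqP.
  by rewrite nth_uniq // => /eqP/val_inj.
move=> p; apply/mapP/idP => [[i]|pD]; first by rewrite mem_enum inE => ? ->.
have [i ip] := point_index (Ds p pD).
by exists i; rewrite ?mem_enum ?inE ip.
Qed.

Lemma dominating_indices D : D `<=` S -> dominating_set S D <-> dominates (indices D).
Proof.
move=> DS; have Ds : {subset D <= s} by move=> p /(fsubsetP DS); rewrite sS.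
split=> [[_ H] i|H].
  have [|q qD qi] := H (point i); first by rewrite -sS mem_nth.
  have [j jq] := point_index (Ds q qD); exists j; first by rewrite inE jq.
  by rewrite -edist_near jq edist_sym.
split=> // p; rewrite -sS => /point_index[i <-]; have [j] := H i.
by rewrite inE -edist_near edist_sym; exists (point j).
Qed.

Definition points (D : {set 'I_n}) : {fset R * R} :=
  [fset p in s | [exists i in D, point i == p]].

Lemma points_sub D : points D `<=` S.
Proof. by apply/fsubsetP => p; rewrite !inE /= sS => /andP[]. Qed.

Lemma pointsK D : indices (points D) = D.
Proof.
apply/setP => i; rewrite !inE /= mem_nth //=.
apply/exists_inP/idP => [[j jD]|iD]; last by exists i.
by rewrite nth_uniq // => /eqP/val_inj <-.
Qed.

(** A competing index set is the index set of [points D'], of the same size as [s] has no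
    repetition, so minimality among point sets applies to it. *)
Lemma minimum_indices D : minimum_dominating_set S D -> minimum_dominates (indices D).
Proof.
move=> [domD minD]; have DS := domD.1; split; first exact/dominating_indices.
move=> D' domD'; have Ds : {subset D <= s} by move=> p /(fsubsetP DS); rewrite sS.
have Ds' : {subset points D' <= s}.
  by move=> p /(fsubsetP (points_sub D')); rewrite sS.
rewrite card_indices // -[D']pointsK card_indices //; apply: minD.
by apply/dominating_indices; rewrite ?points_sub ?pointsK.
Qed.

Lemma output_indices (st : state R) :
  indices (output_set s st) = [set i : 'I_n | imem st i != 0].
Proof.
by apply/setP => i; rewrite !inE /= mem_nth // index_uniq.
Qed.

Lemma output_sub (st : state R) : output_set s st `<=` S.
Proof. by apply/fsubsetP => p; rewrite !inE /= sS => /andP[]. Qed.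
End Sets.

(** * Approximation ratio and feasibility of the selected set *)

Section Correctness.
Variables (R : realType) (s : seq (R * R)) (k : nat).
Hypothesis k_gt0 : 0 < k.
Local Notation n := (size s).
Local Notation G := (pt_rel s).
Local Notation V := (n.+1 ^ (256 * k)).
Local Notation Z := (V * k).

Lemma Z_gt0 : 0 < Z. Proof. by rewrite muln_gt0 expn_gt0. Qed.

Lemma dist_walk_opt (D : {set 'I_n}) : minimum_dominates D ->
  k * dist G n k Z n (walk G n k Z 0) <= k.+1 * #|D|.
Proof.
move=> minD; have [z zZ hz] := good_walk k_gt0 minD (leqnn V).
apply: leq_trans hz; rewrite leq_mul2l; apply/orP; right.
apply: leq_trans (dist_min G n k n Z_gt0 zZ).
by apply: (proj2 (argminP _ Z_gt0)).
Qed.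

Lemma selected_card (D : {set 'I_n}) : minimum_dominates D ->
  k * #|[set i : 'I_n | selected G n k Z i]| <= k.+1 * #|D|.
Proof.
move=> minD; apply: leq_trans (dist_walk_opt minD).
by rewrite leq_mul2l dist_walk_cost selected_walk_cost orbT.
Qed.

Lemma selected_dominates : dominates [set i : 'I_n | selected G n k Z i].
Proof.
have [D minD] := minimum_dominates_exists s.
(* The comparison with an optimum, together with [k.+1 <= 2 * k], keeps the cost of the walk below
   one penalty. *)
have h : dist G n k Z n (walk G n k Z 0) <= n + n.
  have h1 : #|D| <= n by rewrite -[X in _ <= X]card_ord max_card.
  rewrite -(leq_pmul2l k_gt0); apply: leq_trans (dist_walk_opt minD) _.
  by apply: (@leq_trans (k.+1 * n)); [rewrite leq_mul2l h1|nia].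
move=> p; set r := walk G n k Z 0 %% k.
have /existsP[i /andP[hi near_i]] := walk_dom (rank_lt k r (ltn_ord p)) h.
rewrite -/r nthpt_rank // in near_i.
exists i => //; rewrite inE; apply/existsP.
(* The walk runs backwards, so this index is the layer answering for [p]. *)
have lt_a : n - (rank G n k r p).+1 < n.+1 by rewrite ltnS leq_subr.
by exists (Ordinal lt_a).
Qed.
End Correctness.

Local Open Scope ring_scope.
Local Open Scope fset_scope.

Theorem theorem5 (R : realType) :
  exists C : nat, forall k : nat, (0 < k)%N ->
  exists A : program, forall (S : {fset R * R}) (s : seq (R * R)),
    uniq s -> s =i S ->
  exists (t : nat) (st : state R),
    [/\ exec A (input_state s) t st,
        dominating_set S (output_set s st),
        forall OPT : {fset R * R}, minimum_dominating_set S OPT ->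
          (#|` output_set s st|)%:R
            <= (1 + k%:R^-1) ^+ 2 * (#|` OPT|)%:R :> R
      & (t <= maxn 2 #|` S| ^ (C * k))%N].
Proof.
exists (522 * height_bound + 10)%N => k k_gt0.
exists (cprog (algorithm k)) => S s s_uniq sS.
have [t [st [ex ht out]]] := algorithm_runs s k_gt0; exists t, st.
have sizeS : size s = #|` S| by apply/perm_size/uniq_perm; rewrite ?fset_uniq.
have outE : indices s (output_set s st) =
    [set i : 'I_(size s) | selected (pt_rel s) (size s) k
       ((size s).+1 ^ (256 * k) * k) i].
  by rewrite output_indices //; apply/setP => i; rewrite !inE out.
split=> //; last by rewrite -sizeS.
  apply/(dominating_indices sS); first exact: output_sub.
  by rewrite outE; apply: selected_dominates.
move=> OPT minO; have minI := minimum_indices s_uniq sS minO.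
have [[OS _] _] := minO.
have := selected_card k_gt0 minI; rewrite -outE !card_indices //; last 2 first.
- by move=> p /(fsubsetP (output_sub sS st)); rewrite sS.
- by move=> p /(fsubsetP OS); rewrite sS.
rewrite -(ler_nat R) !natrM => h.
have k0 : (0 < k%:R :> R) by rewrite ltr0n.
set a : R := (#|` OPT|)%:R in h *; have a0 : 0 <= a by rewrite ler0n.
apply: (@le_trans _ _ ((1 + k%:R^-1) * a)).
  rewrite -(ler_pM2l k0) [leRHS](_ : _ = k.+1%:R * a) // -natr1 mulrA.
  by rewrite mulrDr mulr1 divff // gt_eqF.
(* The ratio obtained is [1 + 1/k]; being at least 1, it is at most its square. *)
have v0 : 0 <= k%:R^-1 :> R by rewrite invr_ge0 ltW.
by rewrite ler_wpM2r // expr2 ler_peMl ?addr_ge0 // lerDl.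
Qed.
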